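(* Let $k\geq4$ be even. (i) The elements $H_{r,s}$, where $r,s\geq3$ are odd and $r+s=k$, span $\widetilde{\mathcal D}_k$. (ii) Assume that for all integers $a,b,c\ge1$ with $a+b+c=k$ the identity $$\zeta_{\mathcal A}^{\mathrm f}(a,b,c)=(-1)^{b-1}\sum_{\substack{n+m=k-1\\ n,m\ge1}}\binom na\binom mc\,\zeta_{\mathcal A}^{\mathrm f}(n,1,m)+(-1)^{a+c}\sum_{i=1}^{b-1}\binom{a+i}{a}\binom{b+c-i}{c}\,\mathfrak z^{\mathrm f}(a+i)\,\mathfrak z^{\mathrm f}(b+c-i)$$ holds in $\mathcal Z_{\mathcal A,k}^{\mathrm f}$. Then $$H_{r,s}\longmapsto\zeta_{\mathcal A}^{\mathrm f}(r-1,1,s-1,1)\qquad(r,s\ge3\text{ odd},\ r+s=k)$$ defines a (well-defined) surjective linear map $\beta_k^{\mathrm f}:\widetilde{\mathcal D}_k\to\mathrm{Fil}_4\,\mathcal Z_{\mathcal A,k}^{\mathrm f}$.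
   Context: Formal finite multiple zeta values. Let $\mathfrak H=\mathbb Q\langle x,y\rangle$, $\mathfrak H^1=\mathbb Q+\mathfrak Hy$, $z_k=x^{k-1}y$ for $k\ge1$. The words in $\mathfrak H^1$ are the empty word $\mathbf 1$ and $z_{k_1}\cdots z_{k_r}$ ($k_i\ge1$), of weight $\mathrm{wt}=k_1+\cdots+k_r$ and depth $r$. The stuffle product $*$ on $\mathfrak H^1$ is bilinear with $\mathbf 1*w=w*\mathbf 1=w$ and $z_aw*z_bv=z_a(w*z_bv)+z_b(z_aw*v)+z_{a+b}(w*v)$. The shuffle product $\mathrm{sh}$ on $\mathfrak H$ is bilinear with $\mathbf 1\,\mathrm{sh}\,w=w\,\mathrm{sh}\,\mathbf 1=w$ and $au\,\mathrm{sh}\,bv=a(u\,\mathrm{sh}\,bv)+b(au\,\mathrm{sh}\,v)$ for $a,b\in\{x,y\}$. Let $\mathfrak H^1_*$ be $\mathfrak H^1$ with product $*$, and $R(z_{k_1}\cdots z_{k_r})=z_{k_r}\cdots z_{k_1}$. Put $\mathcal Z_{\mathcal A}^{\mathrm f}=\mathfrak H^1_*/\mathfrak L$, where $\mathfrak L$ is the ideal of $\mathfrak H^1_*$ generated by $w\,\mathrm{sh}\,v-(-1)^{\mathrm{wt}(w)}R(w)v$ for all words $w,v\in\mathfrak H^1$ ($R(w)v$ is concatenation). It is graded by weight with weight-$k$ part $\mathcal Z_{\mathcal A,k}^{\mathrm f}$; $\zeta_{\mathcal A}^{\mathrm f}(k_1,\ldots,k_r)$ is the class of $z_{k_1}\cdots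 z_{k_r}$, and $\mathrm{Fil}_d\,\mathcal Z_{\mathcal A,k}^{\mathrm f}=\mathrm{span}_{\mathbb Q}\{\zeta_{\mathcal A}^{\mathrm f}(k_1,\ldots,k_r):r\le d,\ k_1+\cdots+k_r=k\}$. Set $\mathfrak z^{\mathrm f}(1)=0$ and $\mathfrak z^{\mathrm f}(k)=\frac1k\zeta_{\mathcal A}^{\mathrm f}(k-1,1)$ for $k\ge2$. Formal double zeta space. For $k\ge3$, $\mathcal D_k$ is the $\mathbb Q$-vector space generated by symbols $Z_{r,s},P_{r,s}$ ($r,s\ge1$, $r+s=k$) and $Z_k$ subject to $$P_{r,s}=Z_{r,s}+Z_{s,r}+Z_k=\sum_{\substack{a+b=k\\ a,b\ge1}}\left[\binom{a-1}{r-1}+\binom{a-1}{s-1}\right]Z_{a,b}.$$ For even $k$, $\widetilde{\mathcal D}_k=\mathcal D_k\big/\bigl(\mathbb QZ_k+\mathbb QZ_{1,k-1}+\mathrm{span}_{\mathbb Q}\{P_{r,s}:r,s\text{ even},\ r+s=k\}\bigr)$; the same symbols denote classes in the quotient. For odd $r,s\ge3$ with $r+s=k$, $$H_{r,s}=\frac12\Bigg((rs-r+1)Z_{r,s}+(rs+s-1)Z_{s,r}+(s+1)Z_{s+1,r-1}-(r+1)Z_{r+1,s-1}+\sum_{\substack{3\le\ell\le k-3\\ \ell\text{ odd}}}\left(\binom{k-\ell}{s}-\binom{k-\ell}{r}\right)P_{\ell,k-\ell}\Bigg)\in\widetilde{\mathcal D}_k.$$ *)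

(* Defs.v *)
From HB Require Import structures.
From mathcomp Require Import all_boot all_order all_algebra.
From mathcomp Require Import ring_quotient finmap boolp monalg zify.

Set Implicit Arguments.
Unset Strict Implicit.
Unset Printing Implicit Defensive.

Import GRing.Theory.

Local Open Scope ring_scope.

Section Span.
Variables (K : nzRingType) (V : lmodType K) (G : V -> Prop).

Definition in_lspan (v : V) : Prop :=
  exists2 s : seq (K * V),
    {in s, forall p, G p.2} & v = \sum_(p <- s) p.1 *: p.2.

Definition lspan : {pred V} := fun v => `[< in_lspan v >].

Lemma lspanP v : reflect (in_lspan v) (v \in lspan).
Proof. exact: asboolP. Qed.

Lemma mem_lspan v : G v -> v \in lspan.
Proof.
move=> Gv; apply/lspanP; exists [:: (1, v)].
  by move=> p; rewrite inE => /eqP->.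
by rewrite big_seq1 scale1r.
Qed.

Lemma lspan_submod_closed : submod_closed lspan.
Proof.
split=> [|a u v /lspanP[s Gs ->] /lspanP[t Gt ->]]; apply/lspanP.
  by exists [::]; rewrite ?big_nil.
exists ([seq (a * p.1, p.2) | p <- s] ++ t) => [p|].
  by rewrite mem_cat => /orP[/mapP[q /Gs Gq ->]|/Gt].
rewrite big_cat big_map scaler_sumr; congr (_ + _).
by apply: eq_bigr => p _; rewrite scalerA.
Qed.

Lemma lspan_subsemimod_closed : subsemimod_closed lspan.
Proof. exact: GRing.submod_closed_semi lspan_submod_closed. Qed.

HB.instance Definition _ := GRing.isSubmodClosed.Build K V lspan
  lspan_subsemimod_closed.

Definition lspan_mod : Type := {v : V | v \in lspan}.

HB.instance Definition _ := Choice.on lspan_mod.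
HB.instance Definition _ := SubChoice.on lspan_mod.
HB.instance Definition _ := [SubChoice_isSubLmodule of lspan_mod by <:].

Definition quot_mod : Type := Quotient.quot lspan.

HB.instance Definition _ := GRing.Zmodule.on quot_mod.
HB.instance Definition _ := EqQuotient.on quot_mod.

Definition quot_pi (v : V) : quot_mod := (\pi_(Quotient.quot lspan) v)%qT.

Lemma quot_piB : {morph quot_pi : u v / u - v}.
Proof. exact: (raddfB (\pi_(Quotient.quot lspan))%qT). Qed.

Lemma quot_piD : {morph quot_pi : u v / u + v}.
Proof. exact: (raddfD (\pi_(Quotient.quot lspan))%qT). Qed.

Lemma quot_piP u v : quot_pi u = quot_pi v <-> u - v \in lspan.
Proof. by rewrite Quotient.idealrBE; split=> [/eqP|/eqP]. Qed.

Lemma quot_reprK (x : quot_mod) : quot_pi (repr x) = x.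
Proof. exact: reprK. Qed.

Definition quot_scale (a : K) (x : quot_mod) : quot_mod :=
  quot_pi (a *: repr x).

Lemma quot_piZ a v : quot_pi (a *: v) = quot_scale a (quot_pi v).
Proof.
apply/quot_piP; rewrite -scalerBr; apply: rpredZ.
by apply/quot_piP; rewrite quot_reprK.
Qed.

Lemma quot_scaleA a b x : quot_scale a (quot_scale b x) = quot_scale (a * b) x.
Proof. by rewrite -[x]quot_reprK -!quot_piZ scalerA. Qed.

Lemma quot_scale1 : left_id 1 quot_scale.
Proof. by move=> x; rewrite -[x]quot_reprK -!quot_piZ scale1r. Qed.

Lemma quot_scaleDr : right_distributive quot_scale +%R.
Proof.
move=> a x y; rewrite -[x]quot_reprK -[y]quot_reprK.
by rewrite -quot_piD -!quot_piZ scalerDr quot_piD.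
Qed.

Lemma quot_scaleDl x : {morph quot_scale^~ x : a b / a + b}.
Proof.
by move=> a b; rewrite -[x]quot_reprK -!quot_piZ scalerDl quot_piD.
Qed.

HB.instance Definition _ := GRing.Zmodule_isLmodule.Build K quot_mod
  quot_scaleA quot_scale1 quot_scaleDr quot_scaleDl.

HB.instance Definition _ := GRing.isZmodMorphism.Build V quot_mod quot_pi
  quot_piB.
HB.instance Definition _ := GRing.isScalable.Build K V quot_mod *:%R quot_pi
  quot_piZ.

End Span.

Section LinearExtension.
Variables (I : choiceType) (V : lmodType rat).

Definition lin_ext (h : I -> V) (f : {malg rat[I]}) : V :=
  \sum_(i <- msupp f) f@_i *: h i.

Lemma lin_extEw (h : I -> V) (d : {fset I}) f : (msupp f `<=` d)%fset ->
  lin_ext h f = \sum_(i <- d) f@_i *: h i.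
Proof.
move=> le; rewrite /lin_ext (big_fset_incl _ le) //= => i _ /mcoeff_outdom ->.
by rewrite scale0r.
Qed.

Lemma lin_extU (h : I -> V) i : lin_ext h << i >> = h i.
Proof.
by rewrite (lin_extEw _ msuppU_le) big_seq_fset1 mcoeffUU scale1r.
Qed.

Lemma lin_ext_is_linear (h : I -> V) : linear (lin_ext h).
Proof.
move=> a f g; set d := (msupp f `|` msupp g)%fset.
have fd : (msupp f `<=` d)%fset by apply: fsubsetUl.
have gd : (msupp g `<=` d)%fset by apply: fsubsetUr.
have afgd : (msupp (a *: f + g) `<=` d)%fset.
  apply: (fsubset_trans (msuppD_le _ _)); rewrite fsubUset gd andbT.
  exact: (fsubset_trans (msuppZ_le _ _)).
rewrite (lin_extEw _ fd) (lin_extEw _ gd) (lin_extEw _ afgd) scaler_sumr.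
rewrite -big_split; apply: eq_bigr => i _ /=.
by rewrite mcoeffD mcoeffZ scalerDl scalerA.
Qed.

Lemma lin_ext0 (h : I -> V) : lin_ext h 0 = 0.
Proof. by rewrite /lin_ext msupp0 big_seq_fset0. Qed.

Lemma malg_lin_ind (P : {malg rat[I]} -> Prop) :
    P 0 -> (forall a f g, P f -> P g -> P (a *: f + g)) ->
    (forall i, P << i >>) -> forall f, P f.
Proof.
move=> P0 Plin PU f; rewrite [f]monalgE.
elim: (enum_fset (msupp f)) => [|i s IHs]; first by rewrite big_nil.
rewrite big_cons; suff ->: << f@_i *g i >> = f@_i *: << i >> by apply: Plin.
by apply/malgP => j; rewrite mcoeffZ !mcoeffU mulrnAr mulr1.
Qed.

End LinearExtension.

Section BilinearExtension.
Variables (I : choiceType) (V : lmodType rat).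
Implicit Types (op : I -> I -> V) (f g : {malg rat[I]}).

Definition bilin_ext op f g : V := lin_ext (fun i => lin_ext (op i) g) f.

Lemma bilin_extU op i j : bilin_ext op << i >> << j >> = op i j.
Proof. by rewrite /bilin_ext !lin_extU. Qed.

Lemma bilin_extPl op a f1 f2 g :
  bilin_ext op (a *: f1 + f2) g = a *: bilin_ext op f1 g + bilin_ext op f2 g.
Proof. exact: lin_ext_is_linear. Qed.

Lemma bilin_extPr op a f g1 g2 :
  bilin_ext op f (a *: g1 + g2) = a *: bilin_ext op f g1 + bilin_ext op f g2.
Proof.
rewrite /bilin_ext /lin_ext scaler_sumr -big_split; apply: eq_bigr => i _ /=.
by rewrite -/(lin_ext _ _) lin_ext_is_linear scalerDr !scalerA mulrC.
Qed.

Lemma bilin_ext0l op g : bilin_ext op 0 g = 0.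
Proof. exact: lin_ext0. Qed.

Lemma bilin_ext0r op f : bilin_ext op f 0 = 0.
Proof. by have:= bilin_extPr op (-1) f 0 0; rewrite !scaleN1r !addNr. Qed.

Lemma bilin_extDl op f1 f2 g :
  bilin_ext op (f1 + f2) g = bilin_ext op f1 g + bilin_ext op f2 g.
Proof. by rewrite -[f1]scale1r bilin_extPl !scale1r. Qed.

Lemma bilin_extDr op f g1 g2 :
  bilin_ext op f (g1 + g2) = bilin_ext op f g1 + bilin_ext op f g2.
Proof. by rewrite -[g1]scale1r bilin_extPr !scale1r. Qed.

End BilinearExtension.

Section FreeAlgebra.
Variable L : choiceType.
Implicit Types (u v : seq L) (f g : {malg rat[{fmonom L}]}).

Definition word u : {malg rat[{fmonom L}]} := << FMonom u >>.

Lemma word0 : word [::] = 1.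
Proof. by rewrite /word -fmoneE. Qed.

Lemma wordM u v : word u * word v = word (u ++ v).
Proof.
rewrite malgM_def fgmulUU mulr1; congr << _ >>.
exact: (fmmulE (FMonom u) (FMonom v)).
Qed.

Lemma word_cons a u : word (a :: u) = word [:: a] * word u.
Proof. by rewrite wordM. Qed.

Lemma malg_mulrZ a f g : f * (a *: g) = a *: (f * g).
Proof.
have fa : f * a%:MP = a%:MP * f.
  rewrite !malgM_def fgmulUg fgmulgU; apply: eq_bigr => k _.
  by rewrite mul1m mulm1 mulrC.
by rewrite -[a *: g]mul_malgC -[RHS]mul_malgC mulrA fa -mulrA.
Qed.

Lemma malg_mulrP f a g h : f * (a *: g + h) = a *: (f * g) + f * h.
Proof. by rewrite mulrDr malg_mulrZ. Qed.

Lemma word_ind (P : {malg rat[{fmonom L}]} -> Prop) :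
    P 0 -> (forall a f g, P f -> P g -> P (a *: f + g)) ->
    (forall u, P (word u)) -> forall f, P f.
Proof.
by move=> P0 Plin PU; apply: malg_lin_ind => // m; rewrite -[m]fmK; apply: PU.
Qed.

End FreeAlgebra.

(* A product given on words by the quasi-shuffle recursion, for an associative
   and commutative operation add on letters, is associative and commutative. *)
Section QuasiShuffle.
Variables (L : Type) (A : lmodType rat) (add : L -> L -> L).
Variables (w : seq L -> A) (pre : L -> A -> A) (st : A -> A -> A).
Hypothesis addA : associative add.
Hypothesis addC : commutative add.
Hypothesis w_ind : forall P : A -> Prop, P 0 ->
  (forall a f g, P f -> P g -> P (a *: f + g)) -> (forall u, P (w u)) ->
  forall f, P f.
Hypothesis w_cons : forall a u, w (a :: u) = pre a (w u).
Hypothesis preP : forall l a f g, pre l (a *: f + g) = a *: pre l f + pre l g.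
Hypothesis stPl : forall a f1 f2 g, st (a *: f1 + f2) g = a *: st f1 g + st f2 g.
Hypothesis stPr : forall a f g1 g2, st f (a *: g1 + g2) = a *: st f g1 + st f g2.
Hypothesis st0l : forall u, st (w [::]) (w u) = w u.
Hypothesis st0r : forall u, st (w u) (w [::]) = w u.
Hypothesis st_cons : forall a u b v, st (w (a :: u)) (w (b :: v)) =
  pre a (st (w u) (w (b :: v))) + pre b (st (w (a :: u)) (w v))
  + pre (add a b) (st (w u) (w v)).

Let pre0 l : pre l 0 = 0.
Proof. by have:= preP l (-1) 0 0; rewrite !scaleN1r !addNr. Qed.

Let st_0l g : st 0 g = 0.
Proof. by have:= stPl (-1) 0 0 g; rewrite !scaleN1r !addNr. Qed.

Let st_0r f : st f 0 = 0.
Proof. by have:= stPr (-1) f 0 0; rewrite !scaleN1r !addNr. Qed.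

Let preD l f g : pre l (f + g) = pre l f + pre l g.
Proof. by rewrite -[f]scale1r preP !scale1r. Qed.

Let stDl f1 f2 g : st (f1 + f2) g = st f1 g + st f2 g.
Proof. by rewrite -[f1]scale1r stPl !scale1r. Qed.

Let stDr f g1 g2 : st f (g1 + g2) = st f g1 + st f g2.
Proof. by rewrite -[g1]scale1r stPr !scale1r. Qed.

Lemma quasi_shuffle1l f : st (w [::]) f = f.
Proof.
elim/w_ind: f => [|a f g IHf IHg|u]; first exact: st_0r.
  by rewrite stPr IHf IHg.
exact: st0l.
Qed.

Lemma quasi_shuffleC f g : st f g = st g f.
Proof.
have wC u v : st (w u) (w v) = st (w v) (w u).
  elim: u v => [|a u IHu] v; first by rewrite st0l st0r.
  elim: v => [|b v IHv]; first by rewrite st0l st0r.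
  by rewrite !st_cons (IHu (b :: v)) (IHu v) IHv addC [X in X + _ = _]addrC.
elim/w_ind: f g => [g|a f1 f2 IH1 IH2 g|u g].
- by rewrite st_0l st_0r.
- by rewrite stPl stPr IH1 IH2.
elim/w_ind: g => [|a f1 f2 IH1 IH2|v].
- by rewrite st_0l st_0r.
- by rewrite stPl stPr IH1 IH2.
exact: wC.
Qed.

Let st_pre a b f g : st (pre a f) (pre b g) =
  pre a (st f (pre b g)) + pre b (st (pre a f) g) + pre (add a b) (st f g).
Proof.
elim/w_ind: f => [|c f1 f2 IH1 IH2|u].
- by rewrite !(pre0, st_0l) !addr0.
- rewrite !(preP, stPl) IH1 IH2 !scalerDr.
  by rewrite [LHS](AC ((2*1)*(2*1)) ((1*4)*(2*5)*(3*6))).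
elim/w_ind: g => [|c f1 f2 IH1 IH2|v].
- by rewrite !(pre0, st_0r) !addr0.
- rewrite !(preP, stPr) IH1 IH2 !scalerDr.
  by rewrite [LHS](AC ((2*1)*(2*1)) ((1*4)*(2*5)*(3*6))).
by rewrite -!w_cons st_cons.
Qed.

Lemma quasi_shuffleA f g h : st f (st g h) = st (st f g) h.
Proof.
have st1r f' : st f' (w [::]) = f' by rewrite quasi_shuffleC quasi_shuffle1l.
have wA n u v t : (size u + size v + size t <= n)%N ->
    st (w u) (st (w v) (w t)) = st (st (w u) (w v)) (w t).
  elim: n u v t => [|n IHn] [|a u] [|b v] [|c t] //=;
    rewrite ?quasi_shuffle1l ?st1r //.
  - rewrite !addSn !addnS !ltnS => le_n.
    have [IH1 IH2 IH3] : [/\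
        st (w u) (st (w (b :: v)) (w (c :: t)))
          = st (st (w u) (w (b :: v))) (w (c :: t)),
        st (w (a :: u)) (st (w v) (w (c :: t)))
          = st (st (w (a :: u)) (w v)) (w (c :: t))
      & st (w (a :: u)) (st (w (b :: v)) (w t))
          = st (st (w (a :: u)) (w (b :: v))) (w t)].
      by split; apply: IHn => /=; lia.
    have [IH4 IH5 IH6] : [/\
        st (w (a :: u)) (st (w v) (w t)) = st (st (w (a :: u)) (w v)) (w t),
        st (w u) (st (w (b :: v)) (w t)) = st (st (w u) (w (b :: v))) (w t)
      & st (w u) (st (w v) (w (c :: t))) = st (st (w u) (w v)) (w (c :: t))].
      by split; apply: IHn => /=; lia.
    have IH7 : st (w u) (st (w v) (w t)) = st (st (w u) (w v)) (w t).
      by apply: IHn; lia.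
    move: IH1 IH2 IH3 IH4 IH5 IH6.
    rewrite !w_cons !(stDl, stDr, st_pre) => IH1 IH2 IH3 IH4 IH5 IH6.
    rewrite -IH1 IH2 IH3 IH4 IH5 IH6 IH7 addA !preD.
    by rewrite [LHS](AC (3*(1*3*1)*3)
                        (((1*4*9)*5*8)*(2*6*10)*(3*7*11))).
have stA0 f' g' : st 0 (st f' g') = st (st 0 f') g' by rewrite !st_0l.
elim/w_ind: f g h => [|a f1 f2 IH1 IH2|u] g h; first exact: stA0.
  by rewrite !stPl IH1 IH2.
elim/w_ind: g h => [|a g1 g2 IH1 IH2|v] h; first by rewrite st_0l !st_0r st_0l.
  by rewrite !(stPl, stPr) IH1 IH2.
elim/w_ind: h => [|a h1 h2 IH1 IH2|t]; first by rewrite !st_0r.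
  by rewrite !stPr IH1 IH2.
exact: wA (leqnn _).
Qed.

End QuasiShuffle.

(* Q<x, y> with its concatenation product; the letter x is false, y is true. *)
Notation Hxy := {malg rat[{fmonom bool}]}.

Definition let_x : Hxy := word [:: false].
Definition let_y : Hxy := word [:: true].

Fixpoint shuffle_word (u : seq bool) : seq bool -> Hxy :=
  fix shuffle_u (v : seq bool) : Hxy :=
    match u, v with
    | [::], _ => word v
    | _, [::] => word u
    | a :: u', b :: v' =>
        word [:: a] * shuffle_word u' v + word [:: b] * shuffle_u v'
    end.

Definition shuffle : Hxy -> Hxy -> Hxy :=
  bilin_ext (fun u v : {fmonom bool} => shuffle_word u v).

Definition pos : Type := {n : nat | (0 < n)%N}.
HB.instance Definition _ := SubChoice.on pos.

Definition add_pos (a b : pos) : pos :=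
  Sub (val a + val b)%N (ltn_addr (val b) (valP a)).

(* Q + Q<x, y> y, seen as the free algebra on the letters z_k with k : pos:
   z_to_xy below sends z_k to x^(k-1) y and identifies the two, see z_to_xy_inj
   and z_to_xy_image. *)
Notation Hz := {malg rat[{fmonom pos}]}.

(* The word z_(k_1) ... z_(k_r), as an element of Q<x, y>. *)
Definition z_word (w : seq pos) : Hxy :=
  \prod_(k <- w) (let_x ^+ (val k).-1 * let_y).

Definition z_to_xy : Hz -> Hxy := lin_ext (fun w : {fmonom pos} => z_word w).

Lemma z_to_xyP a f g : z_to_xy (a *: f + g) = a *: z_to_xy f + z_to_xy g.
Proof. exact: lin_ext_is_linear. Qed.

HB.instance Definition _ :=
  GRing.isLinear.Build rat Hz Hxy *:%R z_to_xy z_to_xyP.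

Definition wt (w : seq pos) : nat := (\sum_(k <- w) val k)%N.

Fixpoint stuffle_word (u : seq pos) : seq pos -> Hz :=
  fix stuffle_u (v : seq pos) : Hz :=
    match u, v with
    | [::], _ => word v
    | _, [::] => word u
    | a :: u', b :: v' =>
        word [:: a] * stuffle_word u' v + word [:: b] * stuffle_u v'
        + word [:: add_pos a b] * stuffle_word u' v'
    end.

Definition stuffle : Hz -> Hz -> Hz :=
  bilin_ext (fun u v : {fmonom pos} => stuffle_word u v).

Lemma shuffle_wordE u v : shuffle (word u) (word v) = shuffle_word u v.
Proof. exact: bilin_extU. Qed.

Lemma shuffle_word0 u : shuffle_word u [::] = word u.
Proof. by case: u. Qed.

Lemma shuffle_word_cons a u b v :
  shuffle_word (a :: u) (b :: v) =
    word [:: a] * shuffle_word u (b :: v)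
    + word [:: b] * shuffle_word (a :: u) v.
Proof. by []. Qed.

Lemma stuffle_wordE u v : stuffle (word u) (word v) = stuffle_word u v.
Proof. exact: bilin_extU. Qed.

Lemma stuffle_word0 u : stuffle_word u [::] = word u.
Proof. by case: u. Qed.

Lemma stuffle_word_cons a u b v :
  stuffle_word (a :: u) (b :: v) =
    word [:: a] * stuffle_word u (b :: v)
    + word [:: b] * stuffle_word (a :: u) v
    + word [:: add_pos a b] * stuffle_word u v.
Proof. by []. Qed.

Lemma z_to_xy_word w : z_to_xy (word w) = z_word w.
Proof. exact: lin_extU. Qed.

Definition xy_word (w : seq pos) : seq bool :=
  flatten [seq rcons (nseq (val k).-1 false) true | k <- w].

Lemma z_wordE w : z_word w = word (xy_word w).
Proof.
have Hxn n : let_x ^+ n = word (nseq n false).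
  elim: n => [|n IHn]; first by rewrite expr0 word0.
  by rewrite exprS IHn wordM.
rewrite /z_word; elim: w => [|k w IHw]; first by rewrite big_nil word0.
by rewrite big_cons IHw Hxn !wordM cats1.
Qed.

Fixpoint z_split (n : nat) (u : seq bool) : seq pos :=
  match u with
  | [::] => [::]
  | false :: u' => z_split n.+1 u'
  | true :: u' => Sub n.+1 (ltn0Sn n) :: z_split 0 u'
  end.

Lemma xy_wordK : cancel xy_word (z_split 0).
Proof.
rewrite /xy_word; elim=> [//|k w IHw] /=.
have zs n m s : z_split n (nseq m false ++ s) = z_split (n + m) s.
  by elim: m n => [|m IHm] n; rewrite ?addn0 //= IHm addnS addSn.
rewrite cat_rcons zs /= IHw; congr (_ :: _); apply: val_inj => /=.
by rewrite prednK ?(valP k).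
Qed.

Definition ends_y (u : seq bool) : bool := last true u.

Lemma z_splitK u : ends_y u -> xy_word (z_split 0 u) = u.
Proof.
have H n : ends_y u ->
    (u != [::]) || (n == 0)%N -> xy_word (z_split n u) = nseq n false ++ u.
  rewrite /ends_y; elim: u n => [|[] u IHu] n /=.
  - by move=> _ /eqP->.
  - move=> lu _; rewrite /xy_word /= -/(xy_word _) IHu ?eqxx ?orbT //.
    by rewrite cat_rcons.
  case: u IHu => [//|b u] IHu lu _; rewrite (IHu n.+1 lu isT).
  by elim: n {IHu lu} => //= n ->.
by move=> yu; rewrite H ?orbT.
Qed.

Fact lin_congr (V : lmodType rat) c (x x' y y' : V) :
  x = x' -> y = y' -> c *: x + y = c *: x' + y'.
Proof. by move=> -> ->. Qed.

Lemma z_to_xy_inj : injective z_to_xy.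
Proof.
pose split1 : Hxy -> Hz :=
  lin_ext (fun u : {fmonom bool} => word (z_split 0 u)).
have split10 : split1 0 = 0 by exact: lin_ext0.
have split1P a f g : split1 (a *: f + g) = a *: split1 f + split1 g.
  exact: lin_ext_is_linear.
apply: (@can_inj _ _ _ split1); elim/word_ind => [|a f g IHf IHg|w].
- by rewrite linear0.
- by rewrite z_to_xyP split1P; apply: lin_congr.
by rewrite z_to_xy_word z_wordE /split1 lin_extU xy_wordK.
Qed.

Lemma z_to_xy_image (f : Hxy) :
  (exists g, z_to_xy g = f) <-> (exists (c : rat) h, f = c *: 1 + h * let_y).
Proof.
split=> [[g <-]|[c [h ->]]].
  elim/word_ind: g => [|a f1 f2 [c1 [h1 IH1]] [c2 [h2 IH2]]|w].
  - by exists 0, 0; rewrite linear0 scale0r mul0r addr0.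
  - exists (a * c1 + c2), (a *: h1 + h2).
    rewrite z_to_xyP IH1 IH2 scalerDr scalerDl scalerA mulrDl -scalerAl.
    by rewrite [LHS](AC (2*2) ((1*3)*(2*4))).
  rewrite z_to_xy_word; case/lastP: w => [|w k].
    by exists 1, 0; rewrite /z_word big_nil scale1r mul0r addr0.
  exists 0, (z_word w * let_x ^+ (val k).-1).
  by rewrite scale0r add0r /z_word big_rcons /= mulrA.
have ihy : exists g, z_to_xy g = h * let_y.
  elim/word_ind: h => [|a f1 f2 [h1 IH1] [h2 IH2]|u].
  - by exists 0; rewrite linear0 mul0r.
  - by exists (a *: h1 + h2); rewrite z_to_xyP IH1 IH2 mulrDl -scalerAl.
  exists (word (z_split 0 (u ++ [:: true]))).
  by rewrite z_to_xy_word z_wordE z_splitK ?wordM // /ends_y last_cat.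
case: ihy => g <-; exists (c *: word [::] + g).
by rewrite z_to_xyP z_to_xy_word /z_word big_nil.
Qed.

Lemma shuffle_z_word (u v : seq pos) :
  exists g, z_to_xy g = shuffle (z_word u) (z_word v).
Proof.
pose Q (f : Hxy) := exists h, f = h * let_y.
have QM f g : Q g -> Q (f * g) by move=> [h ->]; exists (f * h); rewrite mulrA.
have QD f g : Q f -> Q g -> Q (f + g).
  by move=> [h1 ->] [h2 ->]; exists (h1 + h2); rewrite mulrDl.
have Qw a s : ends_y (a :: s) -> Q (word (a :: s)).
  rewrite lastI /ends_y last_rcons => ->.
  by exists (word (belast a s)); rewrite -cats1 -wordM.
have ends_y_behead a s : ends_y (a :: s) -> ends_y s.
  by rewrite /ends_y; case: s.
have Qsh s t : ends_y s -> ends_y t -> (s != [::]) || (t != [::]) ->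
    Q (shuffle_word s t).
  elim: s t => [|a s IHs]; first by case=> // b t _ yt _; apply: Qw.
  elim=> [|b t IHt] ys yt _; first by rewrite shuffle_word0; apply: Qw.
  rewrite shuffle_word_cons; apply: QD; apply: QM.
    by apply: IHs; rewrite ?orbT // (ends_y_behead _ _ ys).
  by apply: IHt; rewrite // (ends_y_behead _ _ yt).
have yz w : ends_y (xy_word w).
  case/lastP: w => // w k.
  by rewrite /ends_y /xy_word map_rcons flatten_rcons last_cat last_rcons.
apply/z_to_xy_image; rewrite !z_wordE shuffle_wordE.
have [e|] := boolP ((xy_word u != [::]) || (xy_word v != [::])).
  have [h ->] := Qsh _ _ (yz u) (yz v) e.
  by exists 0, h; rewrite scale0r add0r.
rewrite negb_or !negbK => /andP[/eqP-> /eqP->].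
by exists 1, 0; rewrite scale1r mul0r addr0 /= word0.
Qed.

(* The same Q-vector space as Hz, with the stuffle product as multiplication
   in place of concatenation. *)
Definition Hz_stuffle : Type := Hz.

HB.instance Definition _ := GRing.Lmodule.on Hz_stuffle.

Fact add_posC : commutative add_pos.
Proof. by move=> a b; apply: val_inj; rewrite /= addnC. Qed.

Fact add_posA : associative add_pos.
Proof. by move=> a b c; apply: val_inj; rewrite /= addnA. Qed.

Fact stuffle0w u : stuffle (word [::]) (word u) = word u.
Proof. by rewrite stuffle_wordE; case: u. Qed.

Fact stufflew0 u : stuffle (word u) (word [::]) = word u.
Proof. by rewrite stuffle_wordE stuffle_word0. Qed.

Fact stuffle_ww_cons a u b v :
  stuffle (word (a :: u)) (word (b :: v)) =
    word [:: a] * stuffle (word u) (word (b :: v))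
    + word [:: b] * stuffle (word (a :: u)) (word v)
    + word [:: add_pos a b] * stuffle (word u) (word v).
Proof.
rewrite (stuffle_wordE (a :: u) (b :: v)) stuffle_word_cons.
by rewrite -3!stuffle_wordE.
Qed.

Fact stuffleZl c (f g : Hz) : stuffle (c *: f) g = c *: stuffle f g.
Proof.
by rewrite -[c *: f]addr0 /stuffle bilin_extPl bilin_ext0l addr0.
Qed.

Fact stuffleA : associative (stuffle : Hz_stuffle -> Hz_stuffle -> Hz_stuffle).
Proof.
exact: (quasi_shuffleA add_posA add_posC (@word_ind _) (@word_cons _)
  (fun a => malg_mulrP (word [:: a])) (bilin_extPl _) (bilin_extPr _)
  stuffle0w stufflew0 stuffle_ww_cons).
Qed.

Fact stuffleC : commutative (stuffle : Hz_stuffle -> Hz_stuffle -> Hz_stuffle).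
Proof.
exact: (quasi_shuffleC (w := @word pos) (pre := fun a f => word [:: a] * f)
  add_posC (@word_ind _)
  (bilin_extPl _) (bilin_extPr _) stuffle0w stufflew0 stuffle_ww_cons).
Qed.

Fact stuffle1l :
  left_id (word [::]) (stuffle : Hz_stuffle -> Hz_stuffle -> Hz_stuffle).
Proof.
exact: (quasi_shuffle1l (w := @word pos) (@word_ind _) (bilin_extPr _)
  stuffle0w).
Qed.

Fact stuffleDl :
  left_distributive (stuffle : Hz_stuffle -> Hz_stuffle -> Hz_stuffle) +%R.
Proof. by move=> f g h; apply: bilin_extDl. Qed.

Fact word0_neq0 : word [::] != 0 :> Hz_stuffle.
Proof. by rewrite monalgU_eq0 oner_eq0. Qed.

HB.instance Definition _ := GRing.Zmodule_isComNzRing.Build Hz_stuffle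
  stuffleA stuffleC stuffle1l stuffleDl word0_neq0.

Fact stuffle_scalerAl c (f g : Hz_stuffle) :
  c *: (f * g) = (c *: f : Hz_stuffle) * g.
Proof. exact/esym/stuffleZl. Qed.

HB.instance Definition _ := GRing.Lmodule_isLalgebra.Build rat Hz_stuffle
  stuffle_scalerAl.
HB.instance Definition _ := GRing.Lalgebra_isComAlgebra.Build rat Hz_stuffle.

Section Ideal.
Variables (R : comNzRingType) (G : R -> Prop).

Definition in_ideal (f : R) : Prop :=
  exists2 s : seq (R * R),
    {in s, forall p, G p.2} & f = \sum_(p <- s) p.1 * p.2.

Definition ideal : {pred R} := fun f => `[< in_ideal f >].

Lemma idealP f : reflect (in_ideal f) (f \in ideal).
Proof. exact: asboolP. Qed.

Lemma ideal_closed : 1 \notin ideal -> idealr_closed ideal.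
Proof.
move=> n1; split=> // [|a u v /idealP[s Gs ->] /idealP[t Gt ->]]; apply/idealP.
  by exists [::]; rewrite ?big_nil.
exists ([seq (a * p.1, p.2) | p <- s] ++ t) => [p|].
  by rewrite mem_cat => /orP[/mapP[q /Gs Gq ->]|/Gt].
rewrite big_cat big_map mulr_sumr; congr (_ + _).
by apply: eq_bigr => p _; rewrite mulrA.
Qed.

End Ideal.

(* g is w sh v - (-1)^wt(w) R(w) v for words w, v: the shuffle is computed in
   Q<x, y> and read back through the injection z_to_xy; the right-hand side is
   always in its image by shuffle_z_word. *)
Definition ZAf_relator (g : Hz_stuffle) : Prop :=
  exists w v : seq pos,
    z_to_xy g = shuffle (z_word w) (z_word v)
              - (-1) ^+ wt w *: z_word (rev w ++ v).

Definition ZAf_ideal : {pred Hz_stuffle} := ideal ZAf_relator.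

Section Augmentation.
Variable L : choiceType.
Local Notation A := {malg rat[{fmonom L}]}.

Definition aug (f : A) : rat := f@_(FMonom [::]).

Lemma augP a f g : aug (a *: f + g) = a * aug f + aug g.
Proof. by rewrite /aug mcoeffD mcoeffZ. Qed.

Lemma aug_word u : aug (word u) = (u == [::])%:R.
Proof. by rewrite /aug mcoeffU -val_eqE. Qed.

Lemma aug_word_mul a f : aug (word [:: a] * f) = 0.
Proof.
have lin0 c (x y : rat) : x = 0 -> y = 0 -> c * x + y = 0.
  by move=> -> ->; rewrite mulr0 addr0.
elim/word_ind: f => [|c f g IHf IHg|u].
- by rewrite mulr0 /aug mcoeff0.
- rewrite malg_mulrP augP; apply: lin0; [exact: IHf|exact: IHg].
by rewrite wordM aug_word.
Qed.

Lemma aug_bilin (op : A -> A -> A) :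
    (forall a f1 f2 g, op (a *: f1 + f2) g = a *: op f1 g + op f2 g) ->
    (forall a f g1 g2, op f (a *: g1 + g2) = a *: op f g1 + op f g2) ->
    (forall u v, aug (op (word u) (word v)) = aug (word u) * aug (word v)) ->
  forall f g, aug (op f g) = aug f * aug g.
Proof.
move=> opl opr opw; have aug0 : aug 0 = 0 by rewrite /aug mcoeff0.
have op0l g : op 0 g = 0.
  by have:= opl (-1) 0 0 g; rewrite !scaleN1r !addNr.
have op0r f : op f 0 = 0.
  by have:= opr (-1) f 0 0; rewrite !scaleN1r !addNr.
elim/word_ind=> [g|a f1 f2 IH1 IH2 g|u g].
- by rewrite op0l aug0 mul0r.
- by rewrite opl !augP IH1 IH2 mulrDl mulrA.
elim/word_ind: g => [|a f1 f2 IH1 IH2|v]; last exact: opw.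
- by rewrite op0r aug0 mulr0.
by rewrite opr !augP IH1 IH2 mulrDr mulrCA.
Qed.

End Augmentation.

Lemma augD (L : choiceType) (f g : {malg rat[{fmonom L}]}) :
  aug (f + g) = aug f + aug g.
Proof. by rewrite /aug mcoeffD. Qed.

Fact add00 (x y : rat) : x = 0 -> y = 0 -> x + y = 0.
Proof. by move=> -> ->. Qed.

Lemma aug_shuffle f g : aug (shuffle f g) = aug f * aug g.
Proof.
apply: aug_bilin => [????|????|u v]; [exact: bilin_extPl|exact: bilin_extPr|].
rewrite shuffle_wordE !aug_word.
case: u v => [|a u] [|b v]; rewrite ?shuffle_word0 ?aug_word ?mulr1 ?mulr0 //.
rewrite shuffle_word_cons augD.
by apply: add00; [exact: aug_word_mul|exact: aug_word_mul].
Qed.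

Lemma aug_stuffle f g : aug (stuffle f g) = aug f * aug g.
Proof.
apply: aug_bilin => [????|????|u v]; [exact: bilin_extPl|exact: bilin_extPr|].
rewrite stuffle_wordE !aug_word.
case: u v => [|a u] [|b v]; rewrite ?stuffle_word0 ?aug_word ?mulr1 ?mulr0 //.
rewrite stuffle_word_cons 2!augD.
by do 2?[apply: add00]; exact: aug_word_mul.
Qed.

Lemma aug_z_word w : aug (z_word w) = (w == [::])%:R.
Proof.
rewrite z_wordE aug_word; case: w => [//|k w].
by rewrite /xy_word /=; case: (val k).-1.
Qed.

Lemma aug_z_to_xy g : aug (z_to_xy g) = aug g.
Proof.
elim/word_ind: g => [|a f1 f2 IH1 IH2|w].
- by rewrite linear0 /aug !mcoeff0.
- rewrite z_to_xyP 2!augP; exact: (lin_congr (V := rat^o) _ IH1 IH2).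
by rewrite z_to_xy_word aug_z_word aug_word.
Qed.

Lemma ZAf_ideal_proper : (1 : Hz_stuffle) \notin ZAf_ideal.
Proof.
have aug_rel g : ZAf_relator g -> aug g = 0.
  move=> [w [v e]]; rewrite -aug_z_to_xy e addrC -scaleNr augP aug_shuffle.
  rewrite !aug_z_word; case: w {e} => [|k w] /=.
    by rewrite /wt big_nil expr0 mul1r mulN1r addNr.
  rewrite mul0r addr0 rev_cons -cats1 -catA.
  by case: (rev w) => [|? ?]; rewrite mulr0.
have augS f g : aug ((f : Hz_stuffle) * g : Hz_stuffle) = aug f * aug g.
  exact: aug_stuffle.
apply/idealP => -[s Gs e].
suff: aug (1 : Hz_stuffle) = 0 by rewrite aug_word => /eqP; rewrite oner_eq0.
rewrite {}e; elim: s Gs => [|p s IHs] Gs.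
  by rewrite big_nil /aug mcoeff0.
have e0 : aug p.2 = 0 by apply/aug_rel/Gs; rewrite mem_head.
rewrite big_cons augD augS e0 mulr0 add0r.
by apply: IHs => q qs; apply: Gs; rewrite inE qs orbT.
Qed.

HB.instance Definition _ := isIdealr.Build Hz_stuffle ZAf_ideal
  (ideal_closed ZAf_ideal_proper).

Definition ZAf : Type := Quotient.quot ZAf_ideal.

HB.instance Definition _ := GRing.ComNzRing.on ZAf.
HB.instance Definition _ := EqQuotient.on ZAf.

Definition ZAf_pi (f : Hz_stuffle) : ZAf :=
  (\pi_(Quotient.quot ZAf_ideal) f)%qT.

Fact ZAf_piB : {morph ZAf_pi : f g / f - g}.
Proof. exact: (rmorphB (\pi_(Quotient.quot ZAf_ideal))%qT). Qed.

Fact ZAf_piM : monoid_morphism ZAf_pi.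
Proof.
split; first exact: (rmorph1 (\pi_(Quotient.quot ZAf_ideal))%qT).
exact: (rmorphM (\pi_(Quotient.quot ZAf_ideal))%qT).
Qed.

HB.instance Definition _ := GRing.isZmodMorphism.Build Hz_stuffle ZAf ZAf_pi
  ZAf_piB.
HB.instance Definition _ := GRing.isMonoidMorphism.Build Hz_stuffle ZAf ZAf_pi
  ZAf_piM.

Lemma ZAf_piP (f g : Hz_stuffle) : ZAf_pi f = ZAf_pi g <-> f - g \in ZAf_ideal.
Proof. by rewrite Quotient.idealrBE; split=> [/eqP|/eqP]. Qed.

Lemma ZAf_pi_stuffle (f g : Hz) :
  ZAf_pi (stuffle f g) = ZAf_pi f * ZAf_pi g.
Proof. exact: (rmorphM ZAf_pi f g). Qed.

Lemma ZAf_reprK (x : ZAf) : ZAf_pi (repr x) = x.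
Proof. exact: reprK. Qed.

Definition ZAf_scale (a : rat) (x : ZAf) : ZAf :=
  ZAf_pi (a *: repr x : Hz_stuffle).

Fact ZAf_scaleE a x : ZAf_scale a x = ZAf_pi (a%:A : Hz_stuffle) * x.
Proof.
by rewrite -{2}[x]ZAf_reprK -rmorphM -[(_ * _)%R]/(_ : Hz_stuffle) mulr_algl.
Qed.

Fact alg_scalarM (A : comAlgType rat) a b : (a * b)%:A = a%:A * b%:A :> A.
Proof. by rewrite -scalerAl mul1r scalerA. Qed.

Fact ZAf_scaleA a b x : ZAf_scale a (ZAf_scale b x) = ZAf_scale (a * b) x.
Proof.
by rewrite !ZAf_scaleE alg_scalarM rmorphM mulrA.
Qed.

Fact ZAf_scale1 : left_id 1 ZAf_scale.
Proof. by move=> x; rewrite ZAf_scaleE scale1r rmorph1 mul1r. Qed.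

Fact ZAf_scaleDr : right_distributive ZAf_scale +%R.
Proof. by move=> a x y; rewrite !ZAf_scaleE mulrDr. Qed.

Fact ZAf_scaleDl x : {morph ZAf_scale^~ x : a b / a + b}.
Proof. by move=> a b; rewrite !ZAf_scaleE scalerDl rmorphD mulrDl. Qed.

HB.instance Definition _ := GRing.Zmodule_isLmodule.Build rat ZAf
  ZAf_scaleA ZAf_scale1 ZAf_scaleDr ZAf_scaleDl.

Fact ZAf_scalerAl a (x y : ZAf) : a *: (x * y) = a *: x * y.
Proof. by rewrite /GRing.scale /= !ZAf_scaleE mulrA. Qed.

HB.instance Definition _ := GRing.Lmodule_isLalgebra.Build rat ZAf ZAf_scalerAl.
HB.instance Definition _ := GRing.Lalgebra_isComAlgebra.Build rat ZAf.

Fact ZAf_piZ a (f : Hz_stuffle) : ZAf_pi (a *: f) = a *: ZAf_pi f.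
Proof.
by rewrite /GRing.scale /= ZAf_scaleE -rmorphM; congr ZAf_pi; rewrite mulr_algl.
Qed.

HB.instance Definition _ :=
  GRing.isScalable.Build rat Hz_stuffle ZAf *:%R ZAf_pi ZAf_piZ.

(* z_ 0 = 0 is a junk value; only k >= 1 is meaningful. *)
Definition z_ (k : nat) : Hz :=
  if insub k is Some p then word [:: p : pos] else 0.

Definition z_monomial (ks : seq nat) : Hz := \prod_(k <- ks) z_ k.

Lemma z_monomialE (w : seq pos) : z_monomial [seq val k | k <- w] = word w.
Proof.
rewrite /z_monomial; elim: w => [|k w IHw]; first by rewrite big_nil word0.
rewrite map_cons big_cons IHw /z_ valK.
exact: wordM.
Qed.

Definition zetaAf (ks : seq nat) : ZAf := ZAf_pi (z_monomial ks).

Definition zf (k : nat) : ZAf :=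
  if (2 <= k)%N then k%:R^-1 *: zetaAf [:: k.-1; 1%N] else 0.

(* The subspace Fil_d of the weight k part. *)
Definition Fil (d k : nat) : Type :=
  @lspan_mod rat ZAf (fun f => exists ks : seq nat,
    [/\ all (leq 1) ks, (size ks <= d)%N, sumn ks = k & f = zetaAf ks]).

HB.instance Definition _ d k := GRing.Lmodule.on (Fil d k).
HB.instance Definition _ d k := SubChoice.on (Fil d k).

Definition Fil_incl (d k : nat) (z : Fil d k) : ZAf := val z.

Fact Fil_incl_is_linear d k : linear (@Fil_incl d k).
Proof. by move=> a y z; rewrite /Fil_incl linearP. Qed.

HB.instance Definition _ d k :=
  GRing.isLinear.Build rat (Fil d k) ZAf *:%R (@Fil_incl d k)
    (@Fil_incl_is_linear d k).

Lemma Fil_incl_inj d k : injective (@Fil_incl d k).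
Proof. exact: val_inj. Qed.

(* The generators of the double zeta space: Z_(r,s) is inl (inl (r, s)),
   P_(r,s) is inl (inr (r, s)) and Z_k is inr tt. *)
Definition dz_index (k : nat) : Type :=
  {p : nat * nat | [&& (0 < p.1)%N, (0 < p.2)%N & (p.1 + p.2 == k)%N]}.
HB.instance Definition _ k := SubChoice.on (dz_index k).

Definition dz_symbol (k : nat) : Type := (dz_index k + dz_index k + unit)%type.
HB.instance Definition _ k := Choice.on (dz_symbol k).

Section DoubleZetaSpace.
Variable k : nat.
Local Notation F := {malg rat[dz_symbol k]}.

(* freeZ r s and freeP r s are 0 unless r, s >= 1 and r + s = k. *)
Definition freeZ (r s : nat) : F :=
  if insub (r, s) is Some p then << inl (inl p) >> else 0.
Definition freeP (r s : nat) : F :=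
  if insub (r, s) is Some p then << inl (inr p) >> else 0.
Definition freeZk : F := << inr tt >>.

Definition dz_relator (f : F) : Prop :=
  exists r s, [/\ (0 < r)%N, (0 < s)%N, (r + s = k)%N &
    f = freeP r s - (freeZ r s + freeZ s r + freeZk) \/
    f = freeP r s - \sum_(1 <= a < k)
          ('C(a.-1, r.-1) + 'C(a.-1, s.-1))%N%:R *: freeZ a (k - a)%N].

Definition dz_space : Type := quot_mod dz_relator.
HB.instance Definition _ := GRing.Lmodule.on dz_space.

Definition dzZ (r s : nat) : dz_space := quot_pi dz_relator (freeZ r s).
Definition dzP (r s : nat) : dz_space := quot_pi dz_relator (freeP r s).
Definition dzZk : dz_space := quot_pi dz_relator freeZk.

Definition dzt_relator (f : dz_space) : Prop :=
  [\/ f = dzZk, f = dzZ 1 k.-1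
    | exists r s, [/\ (0 < r)%N && ~~ odd r, (0 < s)%N && ~~ odd s,
                     (r + s = k)%N & f = dzP r s]].

Definition dzt_space : Type := quot_mod dzt_relator.
HB.instance Definition _ := GRing.Lmodule.on dzt_space.

Definition dztZ (r s : nat) : dzt_space := quot_pi dzt_relator (dzZ r s).
Definition dztP (r s : nat) : dzt_space := quot_pi dzt_relator (dzP r s).

Definition dztH (r s : nat) : dzt_space :=
  2^-1 *: ((r%:R * s%:R - r%:R + 1) *: dztZ r s
           + (r%:R * s%:R + s%:R - 1) *: dztZ s r
           + (s%:R + 1) *: dztZ s.+1 r.-1
           - (r%:R + 1) *: dztZ r.+1 s.-1
           + \sum_(3 <= l < k - 2 | odd l)
               ('C((k - l)%N, s)%:R - 'C((k - l)%N, r)%:R) *: dztP l (k - l)%N).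

End DoubleZetaSpace.

(* Main.v *)
From HB Require Import structures.
Require Import Defs.
From mathcomp Require Import all_boot all_order all_algebra.
From mathcomp Require Import monalg ring zify.

Set Implicit Arguments.
Unset Strict Implicit.
Unset Printing Implicit Defensive.

Import GRing.Theory.

Local Open Scope ring_scope.

(** Write Z_a for Z_{a,k-a} and P_a for P_{a,k-a}.

    Spanning.  Modulo the span of the H_{r,s} everything has to vanish.  The
    identity H_{r,s} + H_{s,r} = rs P_{r,s} kills every P_a with a odd and
    3 <= a <= k-3; the P_a with a even are zero by definition, and
    P_1 = P_{k-1} = 0 follows from the vanishing of the sum of all P_a.  Now the
    relations of the double zeta space say Z_{k-a} = - Z_a and, for the
    generating polynomial u(X,Y) = sum_a Z_a X^(a-1) Y^(k-a-1), that
    u(X,Y) + u(X,X-Y) = 0.  Comparing coefficients, the second one expresses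
    Z_r, r odd, through Z_a with a < r ([Z_reflection]), whereas H_{r,k-r} = 0
    becomes
      (k-2) Z_r + (k-r+1) Z_{r-1} + (r+1) Z_{r+1} = 0,
    which expresses Z_{r+1} through earlier ones.  The induction starts with
    Z_1 = 0, and with Z_2 = 0, which comes out of the sum of r times the last
    relation over all odd r ([Z2_eq0], [double_shuffle_eq0]).

    Reduction of depth.  In the formal algebra zeta(a) = 0, zeta(a,b) is zero in
    even weight and a rational multiple of zf(a+b) in odd weight, and in even
    weight 2 zeta(a,b,c,d) equals
      - zeta(a+b,c,d) - zeta(a,b+c,d) - zeta(a,b,c+d) - zeta(b,a) zeta(c,d)
    ([zeta1_eq0], [zeta2_even], [zeta2_zf], [zeta4_parity]).  These need only
    the stuffle product, reversal, and the shuffle product by the letter y.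
    Together with the assumed identity they show that Fil_4 is spanned by
    T_n = zeta(n,1,k-1-n) and Q_u = zf(u) zf(k-u).

    The map.  Sum the stuffle relation 0 = zeta(a) zeta(b,c) over b + c fixed
    and insert the assumed identity.  In terms of
    T(x,y) = sum_n T_n x^n y^(k-1-n) and Q(x,y) = sum_u Q_u x^u y^(k-u) this
    says T(1,1) = 0 and
      y T(y-x,y) + x T(x-y,x)
        = pi ((x-y)^k + x^k + y^k) + Q(x,x-y) - Q(y,x-y) + Q(x,y),
    where pi = - Q(1,1) / 2 ([T_gf11], [stuffle_equation]).  Let Qh be Q with
    pi added to the two coefficients u = 1 and u = k-1.  Send P_u to Qh_u and
    Z_r to the coefficient of x^r y^(k-r) in Qh(x-y,y) - y T(x-y,-y).  The
    shuffle relation of the double zeta space then holds because T is symmetric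
    and odd, and the stuffle relation is precisely the functional equation
    ([Z_gf_shuffle], [Z_gf_stuffle]).  That 2 H_{r,s} goes to the right-hand
    side of the depth four reduction of zeta(r-1,1,s-1,1) is one coefficient of
    the functional equation at (X,X-1) ([Zcoef_H], [g_H]).  Finally T and Q
    are recovered from the images of Z and P ([T_Zcoef]), whence surjectivity;
    uniqueness is the spanning statement. *)

(** * Even-weight double shuffle relations with vanishing products *)

Lemma coef_X1_exp (R : comNzRingType) n i : (('X + 1 : {poly R}) ^+ n)`_i = 'C(n, i)%:R.
Proof.
rewrite exprDn coef_sum; under eq_bigr => j _ do
  rewrite expr1n mulr1 coefMn coefXn.
have [le_in|lt_ni] := leqP i n; last first.
  rewrite big1 ?bin_small // => j _; rewrite -[RHS](mul0rn _ 'C(n, j)).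
  by congr (_ *+ _); case: eqP => // e; have := ltn_ord j; lia.
have lt_ni : (n - i < n.+1)%N by lia.
rewrite (bigD1 (Ordinal lt_ni)) //= big1 ?addr0 => [|j ne_j].
  by rewrite (subKn le_in) eqxx bin_sub.
rewrite -[RHS](mul0rn _ 'C(n, j)); congr (_ *+ _).
case: eqP => // e; case/eqP: ne_j; apply: val_inj => /=.
by have := ltn_ord j; lia.
Qed.

Lemma size_X1_exp (R : comNzRingType) n : size (('X + 1 : {poly R}) ^+ n) = n.+1.
Proof. by rewrite -[1]opprK -polyC1 -polyCN size_exp_XsubC. Qed.

Lemma coef_comp_sum (R : comNzRingType) (p q : {poly R}) N i :
  (size p <= N)%N -> (p \Po q)`_i = \sum_(0 <= j < N) p`_j * (q ^+ j)`_i.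
Proof.
move=> le_pN; rewrite comp_polyE coef_sum.
under eq_bigr => j _ do rewrite coefZ.
rewrite -(big_mkord xpredT (fun j => p`_j * (q ^+ j)`_i)).
rewrite (big_cat_nat (leq0n _) le_pN) /=.
rewrite [X in _ = _ + X]big_nat_cond [X in _ = _ + X]big1 ?addr0 //.
by move=> j /andP[/andP[le_j _] _]; rewrite nth_default ?mul0r.
Qed.

(** [z a] and [P a] play Z_{a,k-a} and P_{a,k-a} in a quotient in which the
    products P and the elements H are zero; [H_relation] is what H_{r,k-r} = 0
    becomes there. *)
Section EvenDoubleShuffle.
Variables (V : lmodType rat) (k : nat) (z P : nat -> V).
Hypotheses (k_ge4 : (4 <= k)%N) (k_even : ~~ odd k).
Hypothesis P_stuffle : forall r, (0 < r < k)%N -> P r = z r + z (k - r)%N.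
Hypothesis P_shuffle : forall r, (0 < r < k)%N ->
  P r = \sum_(1 <= a < k) ('C(a.-1, r.-1) + 'C(a.-1, (k - r).-1))%N%:R *: z a.
Hypotheses (z0 : z 0 = 0) (z1 : z 1 = 0) (zk : z k = 0).
Hypothesis P_eq0 : forall r, (1 < r < k.-1)%N -> P r = 0.
Hypothesis H_relation : forall r, (3 <= r)%N -> (r <= k - 3)%N -> odd r ->
  (k - 2)%:R *: z r + (k - r).+1%:R *: z r.-1 + r.+1%:R *: z r.+1 = 0.

Let scale_nat_eq0 n (v : V) : n.+1%:R *: v = 0 -> v = 0.
Proof.
move=> /eqP; rewrite scaler_eq0 => /orP[|/eqP//].
by rewrite Num.Theory.pnatr_eq0.
Qed.

(** This is the shuffle relation for P_1, where all binomials C(a-1,0) are 1;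
    the last term of it cancels against the stuffle form of P_1. *)
Lemma sum_Z_eq0 : \sum_(1 <= a < k) z a = 0.
Proof.
have k0 : (0 < 1 < k)%N by lia.
have := P_shuffle k0; rewrite P_stuffle // z1 add0r subn1.
under eq_bigr => a _ do rewrite bin0 natrD scalerDl scale1r.
rewrite big_split /=.
have ->: \sum_(1 <= a < k) 'C(a.-1, k.-1.-1)%:R *: z a = z k.-1.
  have [n en] : exists n, k = n.+2 by exists k.-2; lia.
  rewrite en big_nat_recr //= binn scale1r big_nat_cond big1 ?add0r //.
  by move=> a /andP[/andP[? ?] _]; rewrite bin_small ?scale0r //; lia.
by move=> e; apply: (addIr (z k.-1)); rewrite -e add0r.
Qed.

Lemma P_reversal r : (0 < r < k)%N -> P (k - r)%N = P r.
Proof.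
move=> hr; have hr' : (0 < k - r < k)%N by lia.
by rewrite (P_stuffle hr) (P_stuffle hr') subKn 1?addrC //; lia.
Qed.

Lemma sum_P_eq0 : \sum_(1 <= a < k) P a = 0.
Proof.
rewrite (eq_big_nat _ _ (F2 := fun a => z a + z (k - a)%N)) => [|a ha]; last first.
  exact: P_stuffle.
rewrite big_split /= [X in _ + X]big_nat_rev /= sum_Z_eq0 add0r -[RHS]sum_Z_eq0.
by apply: eq_big_nat => a ha; congr z; lia.
Qed.

(** Only P_1 = P_{k-1} is missing from the hypotheses; it survives twice in
    the sum of all the P_a, which is twice the sum of the Z_a. *)
Lemma P_eq0_all r : (0 < r < k)%N -> P r = 0.
Proof.
have P1 : P 1 = 0.
  have [n en] : exists n, k = n.+3 by exists (k - 3)%N; lia.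
  have := sum_P_eq0; rewrite {1}en big_nat_recr //= big_ltn //=.
  rewrite big_nat_cond big1 ?addr0 => [|a /andP[ha _]]; last first.
    by apply: P_eq0; lia.
  rewrite -(P_reversal (r := 1)) ?en ?subn1 /= => [e|]; last by lia.
  by apply: (@scale_nat_eq0 1); rewrite scalerDl scale1r.
move=> hr; have [->//|r1] := eqVneq r 1%N.
have [->|rk] := eqVneq r k.-1; first by rewrite -subn1 P_reversal //; lia.
by apply: P_eq0; lia.
Qed.

Lemma Z_antisym r : (0 < r < k)%N -> z (k - r)%N = - z r.
Proof.
move=> hr; apply/eqP; rewrite -addr_eq0 addrC -P_stuffle //.
exact/eqP/P_eq0_all.
Qed.

(** The shuffle relation for P_2, whose binomials C(a-1,1) are the weights. *)
Lemma sum_pred_Z : \sum_(1 <= a < k) a.-1%:R *: z a = z 2.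
Proof.
have k0 : (0 < 2 < k)%N by lia.
have := P_shuffle k0; rewrite P_eq0_all //.
under eq_bigr => a _ do rewrite bin1 natrD scalerDl.
rewrite big_split /=.
have ->: \sum_(1 <= a < k) 'C(a.-1, (k - 2).-1)%:R *: z a = - z 2.
  have [n en] : exists n, k = n.+3 by exists (k - 3)%N; lia.
  have zk1 : z n.+2 = 0.
    have -> : n.+2 = (k - 1)%N by lia.
    by rewrite Z_antisym ?z1 ?oppr0 //; lia.
  have zk2 : z n.+1 = - z 2.
    have -> : n.+1 = (k - 2)%N by lia.
    by rewrite Z_antisym.
  rewrite en big_nat_recr //= zk1 scaler0 addr0 big_nat_recr //= zk2.
  rewrite binn scale1r big_nat_cond big1 ?add0r //.
  by move=> a /andP[/andP[? ?] _]; rewrite bin_small ?scale0r //; lia.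
by move/esym/eqP; rewrite subr_eq0 => /eqP.
Qed.

Lemma sum_nat_double (F : nat -> V) n :
  \sum_(0 <= j < n.*2) F j = \sum_(0 <= i < n) (F i.*2 + F i.*2.+1).
Proof.
elim: n => [|n IHn]; first by rewrite !big_geq.
by rewrite doubleS !big_nat_recr //= IHn addrA.
Qed.

Lemma sum_even_Z_eq0 n : k = n.*2 -> \sum_(0 <= i < n) z i.*2 = 0.
Proof.
move=> en; apply: (@scale_nat_eq0 1); rewrite scalerDl scale1r.
rewrite big_ltn ?z0 ?add0r; last by lia.
rewrite [X in _ + X]big_nat_rev /= -big_split /= big_nat_cond big1 // => i hi.
have -> : (1 + n - i.+1).*2 = (k - i.*2)%N by lia.
by rewrite Z_antisym ?addrN //; lia.
Qed.

(** Let m_r be the left-hand side of [H_relation].  In the sum of r m_r over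
    all odd r in [1,k) each even index 2i receives the coefficient
    (k-2) 2i + k, so that the sum is (k-2) times that of all j Z_j plus k times
    that of the Z_{2i}, which is (k-2) Z_2.  Of the m_r only the two at the ends
    need not vanish, and m_1 = 2 Z_2, m_{k-1} = - 2 Z_2, so that
    3 (k-2) Z_2 = 0. *)
Lemma Z2_eq0 : z 2 = 0.
Proof.
pose m r := (k - 2)%:R *: z r + (k - r).+1%:R *: z r.-1 + r.+1%:R *: z r.+1.
have [n en] : exists n, k = n.+2.*2 by exists (k./2 - 2)%N; lia.
have zk1 : z k.-1 = 0 by rewrite -subn1 Z_antisym ?z1 ?oppr0 //; lia.
have zk2 : z k.-2 = - z 2 by rewrite -subn2 Z_antisym //; lia.
have sum1 : \sum_(0 <= i < n.+2) i.*2.+1%:R *: m i.*2.+1 = (k - 2)%:R *: z 2.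
  have shift : \sum_(0 <= i < n.+2) (i.*2.+1 * i.*2.+2)%:R *: z i.*2.+2
             = \sum_(0 <= i < n.+2) (i.*2.-1 * i.*2)%:R *: z i.*2.
    rewrite [LHS]big_nat_recr //= -doubleS -en zk scaler0 addr0.
    by rewrite [RHS]big_nat_recl //= muln0 scale0r add0r.
  transitivity (\sum_(0 <= j < n.+2.*2) ((k - 2) * j)%:R *: z j
                + k%:R *: \sum_(0 <= i < n.+2) z i.*2).
    rewrite sum_nat_double scaler_sumr.
    under eq_bigr => i _ do rewrite 2!scalerDr !scalerA -!natrM.
    rewrite big_split /= shift -!big_split /= big_nat_cond [RHS]big_nat_cond.
    apply: eq_bigr => i /andP[hi _] /=.
    rewrite -addrA -scalerDl [RHS](ACl (2*(1*3))) /= -scalerDl.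
    by congr (_ *: _ + _ *: _); rewrite -?natrD; congr (_%:R); nia.
  rewrite (sum_even_Z_eq0 en) scaler0 addr0 -en big_ltn ?z0 ?scaler0 ?add0r; last by lia.
  under eq_bigr => j _ do rewrite natrM -scalerA.
  rewrite -scaler_sumr; congr (_ *: _).
  rewrite -sum_pred_Z -[RHS]addr0 -[X in _ = _ + X]sum_Z_eq0 -big_split.
  apply: eq_big_nat => j hj /=.
  by case: j hj => // j _; rewrite -{3}[z _]scale1r -scalerDl -natr1.
have m1 : m 1 = 2%:R *: z 2 by rewrite /m /= z1 z0 !scaler0 !add0r.
have mk : m n.*2.+3 = - 2%:R *: z 2.
  have -> : n.*2.+3 = k.-1 by lia.
  have -> : m k.-1 = (k - 2)%:R *: z k.-1 + (k - k.-1).+1%:R *: z k.-2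
                     + k.-1.+1%:R *: z k.-1.+1 by [].
  rewrite zk1 zk2 scaler0 add0r prednK ?zk ?scaler0 ?addr0; last by lia.
  have -> : (k - k.-1)%N = 1%N by lia.
  by rewrite scalerN scaleNr.
move: sum1; rewrite big_ltn // big_nat_recr //= double0 doubleS m1 mk.
rewrite big_nat_cond big1 ?add0r => [|i /andP[hi _]]; last first.
  by rewrite [m _]H_relation ?scaler0 //; lia.
rewrite scale1r !scalerA -scalerDl => /eqP; rewrite -subr_eq0 -scalerBl => /eqP.
set c := (X in X *: _) => /eqP; rewrite scaler_eq0 => /orP[|/eqP//].
suff -> : c = - (6 * n.+1)%:R by rewrite oppr_eq0 Num.Theory.pnatr_eq0.
rewrite {}/c en; have -> : (n.+2.*2 - 2 = 2 * n.+1)%N by lia.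
have -> : n.*2.+3 = (2 * n + 3)%N by lia.
by rewrite !(natrM, natrD) -natr1; ring.
Qed.

(** Since P = 0, the shuffle relations say u(X+Y,Y) + u(X+Y,X) = 0 for
    u(X,Y) = sum_a Z_a X^(a-1) Y^(k-a-1), that is u(X,1) + u(X,X-1) = 0; this is
    the coefficient of X^(r-1).  In the proof the substitution X -> X - 1 is the
    combination of the relations with weights [e j]. *)
Lemma Z_reflection r : (0 < r < k)%N ->
  z r + \sum_(1 <= a < r.+1) (('X - 1 : {poly rat}) ^+ (k.-1 - a))`_(r - a) *: z a
  = 0.
Proof.
move=> hr; pose e j := (('X - 1 : {poly rat}) ^+ j)`_r.-1.
have XK : ('X + 1 : {poly rat}) \Po ('X - 1) = 'X.
  by rewrite comp_polyD comp_polyX -[1]polyC1 comp_polyC polyC1 subrK.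
have eq1 a : (0 < a < k)%N ->
    \sum_(0 <= j < k.-1) 'C(a.-1, j)%:R * e j = (a == r)%:R.
  move=> ha; under eq_bigr => j _ do rewrite -coef_X1_exp.
  rewrite -coef_comp_sum.
    by rewrite rmorphXn /= XK coefXn; congr ((_ : bool)%:R); apply/eqP/eqP; lia.
  by rewrite size_X1_exp; lia.
have eq2 a : (0 < a < k)%N ->
    \sum_(0 <= j < k.-1) 'C(a.-1, (k - j.+1).-1)%:R * e j
    = if (a <= r)%N then (('X - 1 : {poly rat}) ^+ (k.-1 - a))`_(r - a) else 0.
  move=> ha; pose p : {poly rat} := 'X^(k.-1 - a) * ('X + 1) ^+ a.-1.
  rewrite (eq_big_nat _ _ (F2 := fun j => p`_j * e j)) => [|j hj].
    rewrite -coef_comp_sum ?rmorphM ?rmorphXn /= ?comp_polyX ?XK.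
      rewrite coefMXn; case: ltnP => h1; case: leqP => h2 //; try lia.
      by congr (_`_ _); lia.
    rewrite size_monicM ?monicXn -?size_poly_eq0 ?size_X1_exp //.
    by rewrite size_polyXn; lia.
  rewrite coefXnM coef_X1_exp; case: ltnP => h; first by rewrite bin_small //; lia.
  by rewrite -bin_sub ?[in LHS]leqNgt; [congr (_%:R * _); congr 'C(_, _); lia|lia].
have: \sum_(0 <= j < k.-1) e j *: P j.+1 = 0.
  rewrite big_nat_cond big1 // => j hj; rewrite P_eq0_all ?scaler0 //; lia.
rewrite (eq_big_nat _ _ (F2 := fun j => \sum_(1 <= a < k)
  ('C(a.-1, j)%:R * e j + 'C(a.-1, (k - j.+1).-1)%:R * e j) *: z a)); last first.
  move=> j hj; rewrite P_shuffle; last by lia.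
  rewrite scaler_sumr; apply: eq_bigr => a _.
  by rewrite scalerA natrD mulrDr mulrC [e j * _]mulrC.
rewrite exchange_big_nat /= => {2}<-.
rewrite [RHS](eq_big_nat _ _ (F2 := fun a => (a == r)%:R *: z a +
  (if (a <= r)%N then (('X - 1 : {poly rat}) ^+ (k.-1 - a))`_(r - a) else 0) *: z a)).
  rewrite big_split /=; congr (_ + _).
    rewrite (bigD1_seq r) ?mem_index_iota ?iota_uniq //= eqxx scale1r.
    by rewrite big1 ?addr0 // => a /negPf->; rewrite scale0r.
  have le_rk : (r.+1 <= k)%N by lia.
  rewrite (big_nat_widen _ _ _ _ _ le_rk) big_mkcond /=; apply: eq_bigr => a _.
  by rewrite ltnS; case: ifP; rewrite ?scale0r.
by move=> a ha; rewrite -scaler_suml big_split /= eq1 // eq2 // scalerDl.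
Qed.

(** For r odd the coefficient of Z_r in [Z_reflection] is 1 + (-1)^(k-1-r) = 2,
    and for r even Z_r is the last term of [H_relation] at r - 1. *)
Lemma double_shuffle_eq0 r : (r <= k)%N -> z r = 0.
Proof.
elim/ltn_ind: r => r IH le_rk.
have [->//|r0] := eqVneq r 0%N; have [->//|r1] := eqVneq r 1%N.
have [->|r2] := eqVneq r 2%N; first exact: Z2_eq0.
have [->//|rk] := eqVneq r k.
have [odd_r|even_r] := boolP (odd r).
  have hr : (0 < r < k)%N by lia.
  have := Z_reflection hr; rewrite big_nat_recr /=; last by lia.
  rewrite subnn big_nat_cond big1 ?add0r => [|a /andP[ha _]]; last first.
    by rewrite IH ?scaler0 //; lia.
  have -> : (('X - 1 : {poly rat}) ^+ (k.-1 - r))`_0 = 1.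
    rewrite -horner_coef0 hornerE hornerXsubC sub0r -signr_odd.
    have -> : odd (k.-1 - r) = false by lia.
    by [].
  by move=> e; apply: (@scale_nat_eq0 1); rewrite -[RHS]e scalerDl !scale1r.
have [hr1 hr2] : (3 <= r.-1)%N /\ (r.-1 <= k - 3)%N by lia.
have odd_r1 : odd r.-1 by lia.
have := H_relation hr1 hr2 odd_r1; rewrite IH ?[z r.-2]IH ?scaler0 ?add0r; try lia.
by move=> /scale_nat_eq0; rewrite prednK //; lia.
Qed.

End EvenDoubleShuffle.

(** * The elements H span the reduced double zeta space *)

Lemma scale_combine (V : lmodType rat) (a b c d : rat) (x y w : V) :
  a *: x + b *: - x + c *: - y - d *: w = - ((b - a) *: x + c *: y + d *: w).
Proof. by rewrite !scalerN -scalerBl !opprD -[in RHS]scaleNr opprB. Qed.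

Section DoubleZeta.
Variable k : nat.

Lemma quot_pi_eq0 (K : nzRingType) (V : lmodType K) (G : V -> Prop) v :
  quot_pi G v = 0 <-> v \in lspan G.
Proof. by have := quot_piP G v 0; rewrite subr0 raddf0. Qed.

Lemma dzP_stuffle r s : (0 < r)%N -> (0 < s)%N -> (r + s = k)%N ->
  dzP k r s = dzZ k r s + dzZ k s r + dzZk k.
Proof.
move=> r0 s0 rs; rewrite /dzP /dzZ /dzZk -!raddfD.
by apply/quot_piP/mem_lspan; exists r, s; split=> //; left.
Qed.

Lemma dzP_shuffle r s : (0 < r)%N -> (0 < s)%N -> (r + s = k)%N ->
  dzP k r s = \sum_(1 <= a < k)
    ('C(a.-1, r.-1) + 'C(a.-1, s.-1))%N%:R *: dzZ k a (k - a)%N.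
Proof.
move=> r0 s0 rs; rewrite /dzP /dzZ.
under eq_bigr => a _ do rewrite -linearZ.
rewrite -raddf_sum; apply/quot_piP/mem_lspan.
by exists r, s; split=> //; right.
Qed.

Lemma dztP_stuffle r s : (0 < r)%N -> (0 < s)%N -> (r + s = k)%N ->
  dztP k r s = dztZ k r s + dztZ k s r.
Proof.
move=> r0 s0 rs; rewrite /dztP dzP_stuffle // !raddfD /=.
suff -> : quot_pi (@dzt_relator k) (dzZk k) = 0 by rewrite addr0.
by apply/quot_pi_eq0/mem_lspan; apply: Or31.
Qed.

Lemma dztP_shuffle r s : (0 < r)%N -> (0 < s)%N -> (r + s = k)%N ->
  dztP k r s = \sum_(1 <= a < k)
    ('C(a.-1, r.-1) + 'C(a.-1, s.-1))%N%:R *: dztZ k a (k - a)%N.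
Proof.
move=> r0 s0 rs; rewrite /dztP dzP_shuffle // raddf_sum.
apply: eq_bigr => a _. exact: (@quot_piZ _ _ (@dzt_relator k)).
Qed.

Lemma dztP_even r s : (0 < r)%N -> (0 < s)%N -> (r + s = k)%N ->
  ~~ odd r -> ~~ odd s -> dztP k r s = 0.
Proof.
move=> r0 s0 rs er es; apply/quot_pi_eq0/mem_lspan; apply: Or33.
by exists r, s; rewrite r0 s0 er es.
Qed.

Lemma dztZ1 : dztZ k 1 k.-1 = 0.
Proof. by apply/quot_pi_eq0/mem_lspan; apply: Or32. Qed.

Lemma dztZ_out r s : (r == 0)%N || (s == 0)%N -> dztZ k r s = 0.
Proof.
move=> h; rewrite /dztZ /dzZ /freeZ insubF ?raddf0 //=.
by apply/negbTE; move: h; lia.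
Qed.

(** P and Z_k are expressible through Z, so a linear property of all Z_{r,s}
    holds everywhere. *)
Lemma dzt_ind (Q : dzt_space k -> Prop) :
  Q 0 -> (forall a u v, Q u -> Q v -> Q (a *: u + v)) ->
  (forall r s, (0 < r)%N -> (0 < s)%N -> (r + s = k)%N -> Q (dztZ k r s)) ->
  forall d, Q d.
Proof.
move=> Q0 Qlin QZ d; rewrite -[d]quot_reprK -[repr d]quot_reprK.
elim/malg_lin_ind: (repr (repr d)) => [|a f g Qf Qg|i].
- by rewrite !raddf0.
- by rewrite !linearP /=; apply: Qlin.
have QD u v : Q u -> Q v -> Q (u + v) by rewrite -{2}[u]scale1r; apply: Qlin.
case: i => [[i|i]|[]].
- case: i => -[r s] /= hrs; have /and3P[r0 s0 /eqP rs] := hrs.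
  have := QZ r s r0 s0 rs; rewrite /dztZ /dzZ /freeZ insubT /=.
  by congr (Q (quot_pi _ (quot_pi _ << inl (inl _) >>))); apply: val_inj.
- case: i => -[r s] /= hrs; have /and3P[r0 s0 /eqP rs] := hrs.
  have : Q (dztP k r s).
    by rewrite dztP_stuffle //; apply: QD; apply: QZ; rewrite // addnC.
  rewrite /dztP /dzP /Defs.freeP insubT /=.
  by congr (Q (quot_pi _ (quot_pi _ << inl (inr _) >>))); apply: val_inj.
by rewrite (_ : quot_pi _ _ = 0) //; apply/quot_pi_eq0/mem_lspan; apply: Or31.
Qed.

Definition H_generator (h : dzt_space k) : Prop := exists r s : nat,
  [/\ (3 <= r)%N && odd r, (3 <= s)%N && odd s, (r + s)%N = k & h = dztH k r s].

Definition Hsum r s : dzt_space k := \sum_(3 <= l < k - 2 | odd l)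
  ('C((k - l)%N, s)%:R - 'C((k - l)%N, r)%:R) *: dztP k l (k - l)%N.

Lemma dztHE r s : dztH k r s = 2^-1 *: (
  (r%:R * s%:R - r%:R + 1) *: dztZ k r s + (r%:R * s%:R + s%:R - 1) *: dztZ k s r
  + (s%:R + 1) *: dztZ k s.+1 r.-1 - (r%:R + 1) *: dztZ k r.+1 s.-1 + Hsum r s).
Proof. by []. Qed.

Lemma Hsum_anti r s : Hsum s r = - Hsum r s.
Proof. by rewrite -sumrN; apply: eq_bigr => l _; rewrite -scaleNr opprB. Qed.

(** Apart from the terms rs Z_{r,s} + rs Z_{s,r}, the definition of H_{r,s}
    changes sign when r and s are exchanged. *)
Lemma dztH_add r s : (0 < r)%N -> (0 < s)%N -> (r + s = k)%N ->
  dztH k r s + dztH k s r = (r * s)%:R *: dztP k r s.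
Proof.
move=> r0 s0 rs; rewrite dztP_stuffle // !dztHE -scalerDr.
apply: (@scalerI _ _ (2 : rat)); first by [].
rewrite scalerA divff // scale1r.
set u := dztZ k r s; set v := dztZ k s r.
set w := dztZ k s.+1 r.-1; set x := dztZ k r.+1 s.-1.
rewrite (Hsum_anti r s).
rewrite [LHS](AC (5*5) ((1*7)*(2*6)*((3*9)*(4*8))*(5*10))) /= !addrN addNr !addr0.
rewrite -!scalerDl scalerA scalerDr natrM; congr (_ *: _ + _ *: _); ring.
Qed.

Hypotheses (k_ge4 : (4 <= k)%N) (k_even : ~~ odd k).

(** Membership in the span is equality to zero in the quotient by it, where
    [double_shuffle_eq0] applies. *)
Lemma dztH_span d : d \in lspan H_generator.
Proof.
pose pi := quot_pi H_generator.
pose z a := pi (dztZ k a (k - a)%N); pose P a := pi (dztP k a (k - a)%N).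
have piD u v : pi (u + v) = pi u + pi v by exact: raddfD.
have piN u : pi (- u) = - pi u by exact: raddfN.
have piZ a u : pi (a *: u) = a *: pi u by exact: quot_piZ.
have pi0 : pi 0 = 0 by exact: raddf0.
have H0 r s : (3 <= r)%N && odd r -> (3 <= s)%N && odd s -> (r + s)%N = k ->
    pi (dztH k r s) = 0.
  by move=> hr hs rs; apply/quot_pi_eq0/mem_lspan; exists r, s.
have Pst r : (0 < r < k)%N -> P r = z r + z (k - r)%N.
  move=> hr; rewrite /P /z dztP_stuffle ?piD; try lia.
  by rewrite subKn //; lia.
have Psh r : (0 < r < k)%N -> P r =
    \sum_(1 <= a < k) ('C(a.-1, r.-1) + 'C(a.-1, (k - r).-1))%N%:R *: z a.
  move=> hr; rewrite /P /z dztP_shuffle; try lia.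
  rewrite (big_morph pi piD pi0); by apply: eq_bigr => a _; rewrite piZ.
have P0 r : (1 < r < k.-1)%N -> P r = 0.
  move=> hr; have [odd_r|even_r] := boolP (odd r); last first.
    by rewrite /P dztP_even ?pi0 //; lia.
  have rs_n0 : ((r * (k - r))%:R : rat) != 0.
    by rewrite Num.Theory.pnatr_eq0 muln_eq0; lia.
  apply: (scalerI rs_n0); rewrite scaler0 /P -piZ -dztH_add; try lia.
  have [hr1 hs1] : (3 <= r)%N && odd r /\ (3 <= k - r)%N && odd (k - r) by lia.
  have rs : (r + (k - r))%N = k by lia.
  have sr : (k - r + r)%N = k by lia.
  rewrite piD; apply: etrans (addr0 0).
  exact: (f_equal2 +%R) (H0 _ _ hr1 hs1 rs) (H0 _ _ hs1 hr1 sr).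
suff Z_eq0 r s : (0 < r)%N -> (0 < s)%N -> (r + s = k)%N -> pi (dztZ k r s) = 0.
  apply/quot_pi_eq0; elim/dzt_ind: d => [|a u v Hu Hv|r s]; last exact: Z_eq0.
    exact: pi0.
  by rewrite [LHS]piD piZ [X in _ *: X]Hu [X in _ + X]Hv scaler0 addr0.
move=> r0 s0 rs; have -> : s = (k - r)%N by lia.
have z00 : z 0 = 0 by rewrite /z dztZ_out ?pi0.
have z10 : z 1 = 0 by rewrite /z subn1 dztZ1 pi0.
have zk0 : z k = 0 by rewrite /z dztZ_out ?pi0 // subnn orbT.
apply: (double_shuffle_eq0 (z := z) k_ge4 k_even Pst Psh); rewrite -?rs ?leq_addr //.
move=> {r s r0 s0 rs} r r3 rk odd_r.
have hr : (0 < r < k)%N by lia.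
have hr1 : (0 < r.-1 < k)%N by lia.
have zE i j : (i + j)%N = k -> pi (dztZ k i j) = z i.
  by move=> ij; rewrite /z; congr (pi (dztZ _ _ _)); lia.
have PE l : pi (dztP k l (k - l)%N) = P l by [].
have := H0 r (k - r)%N; rewrite subnKC; last by lia.
have -> : (3 <= r)%N && odd r by lia.
have -> : (3 <= k - r)%N && odd (k - r) by lia.
move=> /(_ isT isT erefl); rewrite dztHE piZ => /eqP.
rewrite scaler_eq0 /= => /eqP; rewrite !piD piN !piZ.
rewrite (big_morph pi piD pi0).
under eq_bigr => l _ do rewrite piZ PE.
rewrite !zE; try lia.
clearbody z P.
have zs : z (k - r)%N = - z r.
  by apply/eqP; rewrite -addr_eq0 addrC -Pst // P0 //; lia.
have zs1 : z (k - r).+1 = - z r.-1.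
  have e1 : (k - r.-1)%N = (k - r).+1 by lia.
  have hr2 : (1 < r.-1 < k.-1)%N by lia.
  apply/eqP; rewrite -addr_eq0 addrC; have := Pst _ hr1.
  by rewrite (P0 _ hr2) e1 => <-.
rewrite big_nat_cond big1 ?addr0 => [|l /andP[hl odd_l]]; last first.
  by rewrite P0 ?scaler0 //; lia.
have ks : (k - r)%:R = k%:R - r%:R :> rat by rewrite natrB //; lia.
have e1 : r%:R * (k - r)%:R + (k - r)%:R - 1 - (r%:R * (k - r)%:R - r%:R + 1)
  = (k - 2)%:R :> rat by rewrite [(k - 2)%:R]natrB; [rewrite ks; ring|lia].
rewrite zs zs1 scale_combine e1 !natr1 => /eqP; rewrite oppr_eq0.
by move/eqP.
Qed.

End DoubleZeta.

(** * Words in the formal algebra: reversal, insertion of y, stuffle *)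

(** Without a lock, unification between two classes of words unfolds the
    quotient and the products of the free algebra, which is very slow. *)
Fact zeta_word_key : unit. Proof. exact: tt. Qed.
Definition zeta_word : seq pos -> ZAf :=
  locked_with zeta_word_key (fun w => ZAf_pi (word w)).

Lemma zeta_wordE w : zeta_word w = ZAf_pi (word w).
Proof. by rewrite /zeta_word unlock. Qed.

Lemma ZAf_pi_sum I (r : seq I) (Q : pred I) (F : I -> Hz) :
  ZAf_pi (\sum_(i <- r | Q i) F i) = \sum_(i <- r | Q i) ZAf_pi (F i).
Proof. exact: raddf_sum. Qed.

Lemma ZAf_pi_relator (g : Hz) (w v : seq pos) :
  z_to_xy g = shuffle (z_word w) (z_word v) ->
  ZAf_pi g = (-1) ^+ wt w *: zeta_word (rev w ++ v).
Proof.
move=> eg; rewrite zeta_wordE -ZAf_piZ; apply/ZAf_piP/idealP.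
exists [:: (1 : Hz_stuffle, g - (-1) ^+ wt w *: word (rev w ++ v) : Hz_stuffle)].
  move=> p; rewrite inE => /eqP -> /=; exists w, v.
  by rewrite raddfB /= linearZ /= z_to_xy_word eg.
by rewrite big_seq1 mul1r.
Qed.

Lemma z_word_cat u v : z_word (u ++ v) = z_word u * z_word v.
Proof. by rewrite /z_word big_cat. Qed.

Lemma z_to_xy_sum I (r : seq I) (Q : pred I) (F : I -> Hz) :
  z_to_xy (\sum_(i <- r | Q i) F i) = \sum_(i <- r | Q i) z_to_xy (F i).
Proof. exact: raddf_sum. Qed.

Definition posn (n : nat) : pos := insubd (Sub 1%N isT) n.

Lemma val_posn n : (0 < n)%N -> val (posn n) = n.
Proof. by move=> n0; rewrite val_insubd n0. Qed.

Lemma add_posn a b : (0 < a)%N -> (0 < b)%N -> add_pos (posn a) (posn b) = posn (a + b).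
Proof. by move=> a0 b0; apply: val_inj; rewrite /= !val_posn ?addn_gt0 ?a0. Qed.

(** The words of y sh v, for v = z_(b_1) ... z_(b_r): the letter y splits one
    block x^(b-1) y into x^i y x^(b-1-i) y, or is appended at the end. *)
Fixpoint y_insert (v : seq pos) : seq (seq pos) :=
  if v is b :: t then
    [seq [:: posn i.+1, posn (val b - i) & t] | i <- index_iota 0 (val b)]
    ++ map (cons b) (y_insert t)
  else [:: [:: posn 1]].

Lemma shuffle_y_block n t :
  shuffle_word [:: true] (nseq n false ++ true :: t) =
    \sum_(0 <= i < n.+1)
      word (nseq i false ++ true :: nseq (n - i) false ++ true :: t)
    + word (nseq n false ++ [:: true]) * shuffle_word [:: true] t.
Proof.
elim: n => [|n IHn].
  by rewrite big_nat1 [nseq 0 _ ++ _]/= shuffle_word_cons wordM.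
have -> : nseq n.+1 false ++ true :: t = false :: (nseq n false ++ true :: t) by [].
rewrite shuffle_word_cons {}IHn mulrDr mulr_sumr mulrA !wordM.
under eq_bigr => i _ do rewrite wordM.
by rewrite [in RHS]big_nat_recl // addrA.
Qed.

Lemma xy_word_cons b v :
  xy_word (b :: v) = nseq (val b).-1 false ++ true :: xy_word v.
Proof. by rewrite /xy_word /= cat_rcons. Qed.

Lemma z_to_xy_insert v :
  z_to_xy (\sum_(w <- y_insert v) word w)
  = shuffle (z_word [:: posn 1]) (z_word v).
Proof.
have z1 : z_word [:: posn 1] = word [:: true].
  by rewrite z_wordE /xy_word /= val_posn.
rewrite z1 z_wordE shuffle_wordE z_to_xy_sum.
under eq_bigr => w _ do rewrite z_to_xy_word.
elim: v => [|b v IHv]; first by rewrite big_seq1 z1.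
have eb : (val b).-1.+1 = val b by rewrite prednK ?(valP b).
rewrite xy_word_cons shuffle_y_block eb -IHv big_cat !big_map mulr_sumr.
apply: (f_equal2 +%R); last first.
  apply: eq_bigr => w _; rewrite -cat1s z_word_cat; congr (_ * _).
  by rewrite z_wordE xy_word_cons.
apply: eq_big_nat => i hi; rewrite z_wordE !xy_word_cons.
have bi0 : (0 < val b - i)%N by lia.
have eb1 : (val b - i).-1 = ((val b).-1 - i)%N by lia.
by rewrite (val_posn (ltn0Sn i)) (val_posn bi0) eb1.
Qed.

(** The generator of the ideal for v the empty word. *)
Lemma zeta_word_rev w : zeta_word (rev w) = (-1) ^+ wt w *: zeta_word w.
Proof.
have e : z_to_xy (word w) = shuffle (z_word w) (z_word [::]).
  by rewrite z_to_xy_word !z_wordE shuffle_wordE shuffle_word0.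
have := ZAf_pi_relator e; rewrite cats0 -zeta_wordE => ->.
by rewrite scalerA -expr2 sqrr_sign scale1r.
Qed.

(** The generator of the ideal for w = y: reversing y does nothing, and its
    weight is odd. *)
Lemma zeta_word_insert v : \sum_(w <- y_insert v) zeta_word w = - zeta_word (posn 1 :: v).
Proof.
have := ZAf_pi_relator (z_to_xy_insert v).
rewrite /wt big_seq1 val_posn // expr1 scaleN1r => <-; rewrite ZAf_pi_sum.
by apply: eq_bigr => w _; rewrite zeta_wordE.
Qed.

(** The stuffle product of two words as a list, so that products of short words
    can be evaluated by computation. *)
Fixpoint stuffle_list (u : seq pos) : seq pos -> seq (seq pos) :=
  fix stuffle_u (v : seq pos) : seq (seq pos) :=
    match u, v with
    | [::], _ => [:: v]
    | _, [::] => [:: u]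
    | a :: u', b :: v' =>
        map (cons a) (stuffle_list u' v) ++ map (cons b) (stuffle_u v')
        ++ map (cons (add_pos a b)) (stuffle_list u' v')
    end.

Lemma stuffle_wordE_list u v :
  stuffle_word u v = \sum_(w <- stuffle_list u v) word w.
Proof.
have pre a (s : seq (seq pos)) :
    word [:: a] * \sum_(w <- s) word w = \sum_(w <- map (cons a) s) word w.
  by rewrite big_map mulr_sumr; apply: eq_bigr => w _; rewrite wordM.
elim: u v => [|a u IHu] v; first by case: v => [|b v]; rewrite big_seq1.
elim: v => [|b v IHv]; first by rewrite stuffle_word0 big_seq1.
have e1 := etrans (f_equal (GRing.mul (word [:: a])) (IHu (b :: v))) (pre _ _).
have e2 := etrans (f_equal (GRing.mul (word [:: b])) IHv) (pre _ _).
have e3 := etrans (f_equal (GRing.mul (word [:: add_pos a b])) (IHu v)) (pre _ _).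
apply: etrans (f_equal2 +%R (f_equal2 +%R e1 e2) e3) _.
by rewrite -addrA -!big_cat.
Qed.

Lemma zeta_word_mul u v :
  zeta_word u * zeta_word v = \sum_(w <- stuffle_list u v) zeta_word w.
Proof.
rewrite !zeta_wordE; under eq_bigr => w _ do rewrite zeta_wordE.
by rewrite -ZAf_pi_sum -stuffle_wordE_list -stuffle_wordE ZAf_pi_stuffle.
Qed.

Lemma stuffle11 a b : zeta_word [:: a] * zeta_word [:: b] =
  zeta_word [:: a; b] + zeta_word [:: b; a] + zeta_word [:: add_pos a b].
Proof. by rewrite zeta_word_mul /= !big_cons big_nil; ring. Qed.

Lemma stuffle12 a b c : zeta_word [:: a] * zeta_word [:: b; c] =
  zeta_word [:: a; b; c] + zeta_word [:: b; a; c] + zeta_word [:: b; c; a]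
  + zeta_word [:: add_pos a b; c] + zeta_word [:: b; add_pos a c].
Proof. by rewrite zeta_word_mul /= !big_cons big_nil; ring. Qed.

Lemma stuffle13 a b c d : zeta_word [:: a] * zeta_word [:: b; c; d] =
  zeta_word [:: a; b; c; d] + zeta_word [:: b; a; c; d] + zeta_word [:: b; c; a; d]
  + zeta_word [:: b; c; d; a] + zeta_word [:: add_pos a b; c; d]
  + zeta_word [:: b; add_pos a c; d] + zeta_word [:: b; c; add_pos a d].
Proof. by rewrite zeta_word_mul /= !big_cons big_nil; ring. Qed.

Lemma stuffle22 a b c d : zeta_word [:: b; a] * zeta_word [:: c; d] =
  zeta_word [:: b; a; c; d] + zeta_word [:: b; c; a; d] + zeta_word [:: b; c; d; a]
  + zeta_word [:: c; b; a; d] + zeta_word [:: c; b; d; a] + zeta_word [:: c; d; b; a]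
  + zeta_word [:: b; add_pos a c; d] + zeta_word [:: b; c; add_pos a d]
  + zeta_word [:: c; add_pos b d; a] + zeta_word [:: c; b; add_pos a d]
  + zeta_word [:: add_pos b c; a; d] + zeta_word [:: add_pos b c; d; a]
  + zeta_word [:: add_pos b c; add_pos a d].
Proof. by rewrite zeta_word_mul /= !big_cons big_nil; ring. Qed.

(** * Depth one, two and four modulo lower depth *)

Notation zeta1 a := (zeta_word [:: posn a]).
Notation zeta2 a b := (zeta_word [:: posn a; posn b]).
Notation zeta3 a b c := (zeta_word [:: posn a; posn b; posn c]).
Notation zeta4 a b c d := (zeta_word [:: posn a; posn b; posn c; posn d]).

Lemma mulrn_inj0 (V : lmodType rat) n (v : V) : v *+ n.+1 = 0 -> v = 0.
Proof.
rewrite -scaler_nat => /eqP; rewrite scaler_eq0 => /orP[|/eqP//].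
by rewrite Num.Theory.pnatr_eq0.
Qed.

Lemma mulrn_div (V : lmodType rat) n m (x y : V) c :
  (c *: y) *+ n = - (x *+ m.+1) -> x = - (n%:R * c / m.+1%:R) *: y.
Proof.
move=> e; have m0 : (m.+1%:R : rat) != 0 by rewrite Num.Theory.pnatr_eq0.
apply: (scalerI m0); rewrite scaler_nat -[LHS]opprK -e scalerA -scaler_nat scalerA.
by rewrite -scaleNr mulrN [_ * (_ / _)]mulrC divfK.
Qed.

Lemma zetaAfE ks : all (leq 1) ks -> zetaAf ks = zeta_word (map posn ks).
Proof.
move=> ks_gt0; rewrite zeta_wordE -z_monomialE -map_comp /zetaAf.
by congr (ZAf_pi (z_monomial _)); rewrite map_id_in // => a /(allP ks_gt0)/= a0;
  rewrite val_posn.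
Qed.

Lemma wt_posn ks : all (leq 1) ks -> wt (map posn ks) = sumn ks.
Proof.
rewrite /wt big_map sumnE => h; apply: eq_big_seq => a /(allP h) /= a0.
by rewrite val_posn.
Qed.

Lemma zeta_word_rev_posn ks : all (leq 1) ks ->
  zeta_word (map posn (rev ks)) = (-1) ^+ sumn ks * zeta_word (map posn ks).
Proof.
move=> h; rewrite map_rev zeta_word_rev wt_posn // -signr_odd scaler_sign.
by rewrite -signr_odd mulr_sign.
Qed.

Lemma insert1 b : (0 < b)%N ->
  \sum_(0 <= i < b) zeta2 i.+1 (b - i)%N + zeta2 b 1 = - zeta2 1 b.
Proof.
move=> b0; rewrite -zeta_word_insert /= big_cat big_map big_seq1 /=.
by rewrite val_posn.
Qed.

Lemma insert2 b c : (0 < b)%N -> (0 < c)%N ->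
  \sum_(0 <= i < b) zeta3 i.+1 (b - i)%N c + \sum_(0 <= i < c) zeta3 b i.+1 (c - i)%N
  + zeta3 b c 1 = - zeta3 1 b c.
Proof.
move=> b0 c0; rewrite -zeta_word_insert /= map_cat -map_comp !big_cat !big_map big_seq1 /=.
by rewrite !val_posn // addrA.
Qed.

(** In odd weight this is reversal.  In even weight n, by induction the stuffle
    product zeta(a) zeta(n-a) is zero, and reversal then gives
    2 zeta(a,n-a) = - zeta(n) for every a.  The shuffle product of y with
    z_(n-1) is a sum of n + 1 such values, hence (n+1) zeta(n) = 0. *)
Lemma zeta1_eq0 n : (0 < n)%N -> zeta1 n = 0.
Proof.
elim/ltn_ind: n => n IH n0.
have rev1 : zeta1 n = (-1) ^+ n * zeta1 n.
  by have := @zeta_word_rev_posn [:: n]; rewrite /= n0 addn0 => /(_ isT).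
have [odd_n|even_n] := boolP (odd n).
  apply: (@mulrn_inj0 _ 1); move: rev1.
  by rewrite -signr_odd odd_n expr1 mulN1r => e; rewrite mulr2n {1}e addNr.
have half a : (0 < a < n)%N -> zeta2 a (n - a)%N *+ 2 = - zeta1 n.
  move=> ha; have [a0 b0] : (0 < a)%N /\ (0 < n - a)%N by lia.
  have := stuffle11 (posn a) (posn (n - a)).
  rewrite add_posn // subnKC; last by lia.
  have := @zeta_word_rev_posn [:: a; (n - a)%N].
  rewrite /= a0 b0 addn0 subnKC; last by lia.
  move=> /(_ isT); rewrite -signr_odd (negPf even_n) mul1r => ->.
  rewrite IH ?mul0r; try lia.
  by move=> e; apply/eqP; rewrite -addr_eq0 mulr2n -e.
have n1 : (0 < n.-1)%N by lia.
have := insert1 n1 => /(congr1 (fun v => v *+ 2)).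
rewrite mulrnDl mulNrn.
have [e1 e2] : zeta2 n.-1 1 *+ 2 = - zeta1 n /\ zeta2 1 n.-1 *+ 2 = - zeta1 n.
  have e : (n - n.-1)%N = 1%N by lia.
  have := half n.-1; have := half 1%N; rewrite e subn1 => h1 h2.
  by split; [apply: h2|apply: h1]; lia.
rewrite e1 e2 -sumrMnl.
rewrite (eq_big_nat _ _ (F2 := fun _ => - zeta1 n)) => [|i hi]; last first.
  have e : (n - i.+1)%N = (n.-1 - i)%N by lia.
  by have := half i.+1; rewrite e; apply; lia.
rewrite sumr_const_nat subn0 opprK => e.
apply: (@mulrn_inj0 _ n); have -> : n.+1 = (n.-1 + 2)%N by lia.
rewrite mulrnDr mulr2n -{3}e mulNrn; ring.
Qed.

Lemma zeta2_even a b : (0 < a)%N -> (0 < b)%N -> ~~ odd (a + b) -> zeta2 a b = 0.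
Proof.
move=> a0 b0 even_ab; apply: (@mulrn_inj0 _ 1).
have := stuffle11 (posn a) (posn b).
rewrite add_posn // !zeta1_eq0 ?addn_gt0 ?a0 // mul0r addr0.
have := @zeta_word_rev_posn [:: a; b]; rewrite /= a0 b0 addn0 => /(_ isT).
by rewrite -signr_odd (negPf even_ab) mul1r => -> ->; rewrite mulr2n.
Qed.

Lemma zeta2_odd a b : (0 < a)%N -> (0 < b)%N -> odd (a + b) -> zeta2 b a = - zeta2 a b.
Proof.
move=> a0 b0 odd_ab.
have := @zeta_word_rev_posn [:: a; b]; rewrite /= a0 b0 addn0 => /(_ isT).
by rewrite -signr_odd odd_ab expr1 mulN1r.
Qed.

Lemma zeta3_rev a b c : (0 < a)%N -> (0 < b)%N -> (0 < c)%N ->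
  zeta3 c b a = (-1) ^+ odd (a + b + c) * zeta3 a b c.
Proof.
move=> a0 b0 c0.
have := @zeta_word_rev_posn [:: a; b; c]; rewrite /= a0 b0 c0 addn0 => /(_ isT) ->.
by rewrite signr_odd addnA.
Qed.

(** The difference zeta(a) zeta(b,c) - zeta(c) zeta(b,a) of two vanishing
    stuffle products, simplified by reversal. *)
Lemma zeta3_parity a b c : (0 < a)%N -> (0 < b)%N -> (0 < c)%N -> odd (a + b + c) ->
  zeta3 a b c *+ 2 = - (zeta2 (a + b) c + zeta2 a (b + c)).
Proof.
move=> a0 b0 c0 odd_abc; apply: subr0_eq.
transitivity (zeta1 a * zeta2 b c - zeta1 c * zeta2 b a); last first.
  by rewrite !zeta1_eq0 // !mul0r subrr.
rewrite !stuffle12 !add_posn // (zeta3_rev a0 b0 c0) odd_abc /= expr1.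
have -> : zeta2 (c + b) a = - zeta2 a (c + b) by apply: zeta2_odd; lia.
rewrite [(c + b)%N]addnC [(c + a)%N]addnC; ring.
Qed.

(** The shuffle product of y with z_b z_c is a sum of triple values of odd
    weight.  Reduced by [zeta3_parity] it becomes a sum of double values, most of
    which cancel because the sum of all zeta(i,n-i) is zero. *)
Lemma zeta2_step b c : (0 < b)%N -> (0 < c)%N -> ~~ odd (b + c) ->
  zeta2 b.+1 c *+ b.+1 = - (zeta2 b c.+1 *+ c.+1).
Proof.
move=> b0 c0 even_bc; set n := (b + c).+1.
have sum0 : \sum_(0 <= i < (b + c)%N) zeta2 i.+1 (n - i.+1)%N = 0.
  apply: (@mulrn_inj0 _ 1); rewrite mulr2n.
  rewrite [X in _ + X]big_nat_rev /= -big_split big_nat_cond big1 // => i /andP[hi _] /=.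
  have -> : (0 + (b + c) - i.+1).+1 = (n - i.+1)%N by lia.
  have -> : (n - (n - i.+1))%N = i.+1 by lia.
  by rewrite [X in _ + X]zeta2_odd ?addrN //; lia.
have := insert2 b0 c0 => /(congr1 (fun v => - (v *+ 2))).
rewrite mulNrn opprK !mulrnDl -!sumrMnl.
rewrite (zeta3_parity b0 c0) ?(@zeta3_parity 1 b c) //; try lia.
rewrite (eq_big_nat _ _ (F2 := fun i =>
   - (zeta2 b.+1 c + zeta2 i.+1 (n - i.+1)))); last first.
  move=> i hi; rewrite zeta3_parity //; try lia.
  by congr (- (zeta_word [:: posn _; _] + zeta_word [:: _; posn _])); lia.
rewrite [X in _ + X + _](eq_big_nat _ _ (F2 := fun i =>
   - (zeta2 (b + i).+1 (n - (b + i).+1) + zeta2 b c.+1))); last first.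
  move=> i hi; rewrite zeta3_parity //; try lia.
  by congr (- (zeta_word [:: posn _; posn _] + zeta_word [:: _; posn _])); lia.
rewrite !sumrN !big_split /= !sumr_const_nat !subn0.
set s1 := \sum_(_ <= _ < b) _; set s2 := \sum_(_ <= _ < c) _.
have sum12 : s1 + s2 = 0.
  rewrite -[RHS]sum0 [in RHS](big_cat_nat (leq0n b) (leq_addr c b)).
  congr (_ + _); rewrite -{1}[b]add0n big_addn addKn.
  by apply: eq_bigr => i _; rewrite addnC.
rewrite !addn1 !add1n.
have -> : zeta2 1 (b + c) = - zeta2 (b + c) 1 by apply: zeta2_odd; lia.
move=> /eqP; rewrite -subr_eq0 => /eqP e; apply: subr0_eq; rewrite !mulrSr.
by rewrite -[RHS]subr0 -[X in _ = X - _]e -[X in _ = _ - X]sum12; ring.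
Qed.

Lemma zf_zeta2 n : (2 <= n)%N -> zf n = n%:R^-1 *: zeta2 n.-1 1.
Proof. by move=> n2; rewrite /zf n2 zetaAfE //= andbT; lia. Qed.

Lemma zf_even n : ~~ odd n -> zf n = 0.
Proof.
move=> even_n; have [n2|lt2] := leqP 2 n; last by rewrite /zf leqNgt lt2.
by rewrite zf_zeta2 // zeta2_even ?scaler0 //; lia.
Qed.

Lemma zf_1 : zf 1 = 0. Proof. by []. Qed.

Lemma zeta2_last1 n : (2 <= n)%N -> zeta2 n.-1 1 = n%:R *: zf n.
Proof.
move=> n2; rewrite zf_zeta2 // scalerA divff ?scale1r //.
by rewrite Num.Theory.pnatr_eq0; lia.
Qed.

(** [zeta2_step] moves one unit from the second to the first argument, until the
    value zeta(n-1,1) is reached. *)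
Lemma zeta2_zf a b : (0 < a)%N -> (0 < b)%N ->
  exists c : rat, zeta2 a b = c *: zf (a + b).
Proof.
move=> a0 b0; have [odd_ab|even_ab] := boolP (odd (a + b)); last first.
  by exists 0; rewrite scale0r zeta2_even.
elim: b b0 a a0 odd_ab => [//|[|b] IHb] _ a a0 odd_ab.
  by exists (a + 1)%:R; rewrite -zeta2_last1 addn1 //=; lia.
have odd_ab1 : odd (a.+1 + b.+1) by rewrite addSnnS.
have [c ec] := IHb isT a.+1 isT odd_ab1.
have even_ab : ~~ odd (a + b.+1) by lia.
have := zeta2_step a0 (ltn0Sn b) even_ab; rewrite ec => e.
exists (- (a.+1%:R * c / b.+2%:R)).
by move: e; rewrite addSnnS; apply: mulrn_div.
Qed.

(** The six quadruple values in zeta(b,a) zeta(c,d) are those in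
    zeta(a) zeta(b,c,d) + zeta(d) zeta(c,b,a), which is zero, other than
    zeta(a,b,c,d) and its reversal.  What is left besides triple values is
    removed with zeta(a) zeta(b+c,d) = 0 and zeta(a+b+c,d) = 0. *)
Lemma zeta4_parity a b c d : (0 < a)%N -> (0 < b)%N -> (0 < c)%N -> (0 < d)%N ->
  ~~ odd (a + b + c + d) ->
  zeta4 a b c d *+ 2 = - (zeta3 (a + b) c d + zeta3 a (b + c) d + zeta3 a b (c + d))
                    - zeta2 b a * zeta2 c d.
Proof.
move=> a0 b0 c0 d0 even_s; apply: subr0_eq.
have rev4 : zeta4 d c b a = zeta4 a b c d.
  have := @zeta_word_rev_posn [:: a; b; c; d].
  rewrite /= a0 b0 c0 d0 addn0 => /(_ isT) ->.
  by rewrite -signr_odd !addnA (negPf even_s) mul1r.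
have rev3 : zeta3 (d + c) b a = zeta3 a b (c + d).
  rewrite [(d + c)%N]addnC zeta3_rev ?addn_gt0 ?c0 // !addnA.
  by rewrite (negPf even_s) mul1r.
have bc0 : (0 < b + c)%N by lia.
have bc_ad : zeta2 (a + (b + c)) d = 0 by apply: zeta2_even; lia.
transitivity (zeta1 a * zeta3 b c d + zeta1 d * zeta3 c b a + zeta1 a * zeta2 (b + c) d
              - zeta2 (a + (b + c)) d); last first.
  by rewrite bc_ad !zeta1_eq0 // !mul0r subr0 !addr0.
rewrite stuffle22 !stuffle13 stuffle12 !add_posn // rev4 rev3.
rewrite [(d + b)%N]addnC [(d + a)%N]addnC; ring.
Qed.

(** * Generating functions of the triple values *)

Lemma big_nat_eq0 (V : nmodType) m n (F : nat -> V) :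
  (forall i, (m <= i < n)%N -> F i = 0) -> \sum_(m <= i < n) F i = 0.
Proof. by move=> F0; rewrite big_nat_cond big1 // => i /andP[/F0]. Qed.

Section PartialBinomial.
Variable R : comNzRingType.
Implicit Types x y : R.

Lemma binomial_tail n N x y : (n < N)%N ->
  \sum_(1 <= a < N) 'C(n, a)%:R * x ^+ a * y ^+ (n - a) = (x + y) ^+ n - y ^+ n.
Proof.
move=> lt_nN; rewrite [x + y]addrC exprDn.
rewrite -(big_mkord xpredT (fun i => y ^+ (n - i) * x ^+ i *+ 'C(n, i))).
rewrite big_ltn //= bin0 subn0 expr0 mulr1 mulr1n addrAC subrr add0r.
rewrite (big_cat_nat _ lt_nN) //= [X in _ + X]big_nat_eq0 ?addr0 => [|a ha].
  by apply: eq_bigr => a _; rewrite -mulr_natl; ring.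
by rewrite bin_small ?mul0r //; lia.
Qed.

Lemma binomial_middle n x y : (0 < n)%N ->
  \sum_(1 <= a < n) 'C(n, a)%:R * x ^+ a * y ^+ (n - a)
  = (x + y) ^+ n - y ^+ n - x ^+ n.
Proof.
move=> n0; rewrite -(binomial_tail _ _ (ltnSn n)) big_nat_recr //=.
by rewrite binn subnn expr0 mulr1 mul1r addrK.
Qed.

End PartialBinomial.

(** The ring is left abstract because the functional equations are used twice:
    over a commutative algebra, and over polynomials with coefficients in it,
    where they can be read off coefficient by coefficient. *)
Section GeneratingFunctions.
Variables (R : comNzRingType) (k : nat) (T Q : nat -> R).

Definition T_gf (x y : R) : R :=
  \sum_(1 <= n < k - 1) x ^+ n * y ^+ (k - 1 - n) * T n.
Definition Q_gf (x y : R) : R := \sum_(1 <= u < k) x ^+ u * y ^+ (k - u) * Q u.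

(** What the functional equations use about T_n = zeta(n,1,k-1-n),
    Q_u = zf(u) zf(k-u), z a b c = zeta(a,b,c) and pi.  As the ring need not be
    an algebra over the rationals, nor a domain, divisions are replaced by
    absence of torsion. *)
Record triple_system (z : nat -> nat -> nat -> R) (pi : R) : Prop := TripleSystem {
  ts_ge4 : (4 <= k)%N;
  ts_even : ~~ odd k;
  ts_torsion : forall n (v : R), v *+ n.+1 = 0 -> v = 0;
  ts_T_sym : forall n, (0 < n < k - 1)%N -> T (k - 1 - n)%N = T n;
  ts_Q_sym : forall u, (0 < u < k)%N -> Q (k - u)%N = Q u;
  ts_Q_even : forall u, ~~ odd u -> Q u = 0;
  ts_Q1 : Q 1 = 0;
  ts_pi : pi *+ 2 = - Q_gf 1 1;
  ts_formula : forall a b c,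
    (0 < a)%N -> (0 < b)%N -> (0 < c)%N -> (a + b + c)%N = k ->
    z a b c = (-1) ^+ (b - 1) * (\sum_(1 <= n < k - 1)
                  ('C(n, a) * 'C((k - 1 - n)%N, c))%N%:R * T n)
              + (-1) ^+ (a + c) * (\sum_(1 <= i < b)
                  ('C((a + i)%N, a) * 'C((b + c - i)%N, c))%N%:R * Q (a + i)%N);
  ts_rev : forall a b c,
    (0 < a)%N -> (0 < b)%N -> (0 < c)%N -> (a + b + c)%N = k -> z c b a = z a b c;
  ts_stuffle : forall a b c,
    (0 < a)%N -> (0 < b)%N -> (0 < c)%N -> (a + b + c)%N = k ->
    z a b c + z b a c + z b c a = 0
}.

Variables (z : nat -> nat -> nat -> R) (pi : R).
Hypothesis sys : triple_system z pi.

Let k_ge4 := ts_ge4 sys.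
Let k_even := ts_even sys.
Let torsion_free := ts_torsion sys.
Let T_sym := ts_T_sym sys.
Let Q_sym := ts_Q_sym sys.
Let Q_even := ts_Q_even sys.
Let pi_def := ts_pi sys.
Let z_formula := ts_formula sys.
Let z_rev := ts_rev sys.
Let z_stuffle := ts_stuffle sys.

Lemma T_gfC x y : T_gf x y = T_gf y x.
Proof.
rewrite /T_gf [LHS]big_nat_rev; apply: eq_big_nat => n hn /=.
have -> : (1 + (k - 1) - n.+1)%N = (k - 1 - n)%N by lia.
by rewrite T_sym // subKn; [ring|lia].
Qed.

Lemma Q_gfC x y : Q_gf x y = Q_gf y x.
Proof.
rewrite /Q_gf [LHS]big_nat_rev; apply: eq_big_nat => n hn /=.
have -> : (1 + k - n.+1)%N = (k - n)%N by lia.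
by rewrite Q_sym // subKn; [ring|lia].
Qed.

Lemma T_gfN x y : T_gf (- x) (- y) = - T_gf x y.
Proof.
rewrite /T_gf -sumrN; apply: eq_big_nat => n hn.
rewrite (exprNn x) (exprNn y) mulrACA -exprD -signr_odd.
have -> : odd (n + (k - 1 - n)) by lia.
by rewrite expr1 mulN1r mulNr.
Qed.

Lemma Q_gfNl x y : Q_gf (- x) y = - Q_gf x y.
Proof.
rewrite /Q_gf -sumrN; apply: eq_bigr => u _.
have [odd_u|even_u] := boolP (odd u); last by rewrite Q_even ?mulr0 ?oppr0.
by rewrite exprNn -signr_odd odd_u; ring.
Qed.

Lemma Q_gfNr x y : Q_gf x (- y) = - Q_gf x y.
Proof. by rewrite Q_gfC Q_gfNl Q_gfC. Qed.

Lemma T_gf0r x : T_gf x 0 = 0.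
Proof.
apply: big_nat_eq0 => n hn.
by rewrite expr0n; case: eqP => [|_]; [lia|rewrite mulr0 mul0r].
Qed.

Lemma Q_gf0r x : Q_gf x 0 = 0.
Proof.
apply: big_nat_eq0 => n hn.
by rewrite expr0n; case: eqP => [|_]; [lia|rewrite mulr0 mul0r].
Qed.

Lemma T_gf_diag x : T_gf x x = x ^+ (k - 1) * T_gf 1 1.
Proof.
rewrite /T_gf mulr_sumr; apply: eq_big_nat => n hn.
by rewrite -exprD !expr1n !mul1r subnKC //; lia.
Qed.

Lemma Q_gf_diag x : Q_gf x x = x ^+ k * Q_gf 1 1.
Proof.
rewrite /Q_gf mulr_sumr; apply: eq_big_nat => n hn.
by rewrite -exprD !expr1n !mul1r subnKC //; lia.
Qed.

Lemma T_gf_split a b c d :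
  \sum_(1 <= n < k - 1) (a ^+ n - b ^+ n) * (c ^+ (k - 1 - n) - d ^+ (k - 1 - n)) * T n
  = T_gf a c - T_gf a d - T_gf b c + T_gf b d.
Proof.
by rewrite /T_gf -!sumrB -big_split; apply: eq_bigr => n _ /=; ring.
Qed.

Lemma Q_gf_split a b c d :
  \sum_(1 <= u < k) (a ^+ u - b ^+ u) * (c ^+ (k - u) - d ^+ (k - u)) * Q u
  = Q_gf a c - Q_gf a d - Q_gf b c + Q_gf b d.
Proof.
by rewrite /Q_gf -!sumrB -big_split; apply: eq_bigr => n _ /=; ring.
Qed.

(** The generating function of the triple values of weight k. *)
Definition Phi (x y w : R) : R :=
  \sum_(1 <= a < k) \sum_(1 <= c < k | (a + c < k)%N)
    x ^+ a * y ^+ (k - a - c) * w ^+ c * z a (k - a - c) c.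

(** Since C(u,a) C(k-u,c) vanishes unless a <= u <= k-c, the sum over
    a < u < k-c is the unrestricted one up to its two end terms. *)
Lemma inner_Q_sum a b c : (0 < a)%N -> (0 < b)%N -> (0 < c)%N -> (a + b + c)%N = k ->
  \sum_(1 <= i < b) ('C((a + i)%N, a) * 'C((b + c - i)%N, c))%N%:R * Q (a + i)%N
  = (\sum_(1 <= u < k) 'C(u, a)%:R * 'C(k - u, c)%:R * Q u)
    - 'C(k - a, c)%:R * Q a - 'C(k - c, a)%:R * Q (k - c)%N.
Proof.
move=> a0 b0 c0 abc; pose F u := 'C(u, a)%:R * 'C(k - u, c)%:R * Q u.
have h2 : (a <= k)%N by lia. have h3 : (a < k)%N by lia.
have h4 : (a.+1 <= a + b)%N by lia. have h5 : (a + b <= k)%N by lia.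
have -> : \sum_(1 <= u < k) F u = F a + (\sum_(a.+1 <= u < a + b) F u + F (a + b)%N).
  rewrite (big_cat_nat a0 h2) /= [X in X + _]big_nat_eq0 ?add0r => [|u hu]; last first.
    by rewrite /F bin_small ?mul0r //; lia.
  rewrite big_ltn //; congr (_ + _); rewrite (big_cat_nat h4 h5) /=.
  congr (_ + _); rewrite big_ltn; last by lia.
  rewrite big_nat_eq0 ?addr0 // => u hu.
  by rewrite /F ['C(k - u, c)]bin_small ?mulr0 ?mul0r //; lia.
have -> : (k - c)%N = (a + b)%N by lia.
have Fa : F a = 'C(k - a, c)%:R * Q a by rewrite /F binn mul1r.
have Fab : F (a + b)%N = 'C(a + b, a)%:R * Q (a + b)%N.
  have ec : (k - (a + b))%N = c by lia.
  by rewrite /F ec binn mulr1.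
have cancel (p q r : R) : p + (q + r) - p - r = q by ring.
rewrite -Fa -Fab cancel.
rewrite -[a.+1]add1n [RHS]big_addn; have -> : (a + b - a)%N = b by lia.
apply: eq_big_nat => i hi; rewrite /F natrM [(i + a)%N]addnC.
by have -> : (b + c - i)%N = (k - (a + i))%N by lia.
Qed.

Lemma sum_triangleC (F : nat -> nat -> R) :
  \sum_(1 <= a < k) \sum_(1 <= c < k | (a + c < k)%N) F a c
  = \sum_(1 <= c < k) \sum_(1 <= a < k | (c + a < k)%N) F a c.
Proof.
under eq_bigr => a _ do rewrite big_mkcond.
rewrite exchange_big; apply: eq_bigr => c _; rewrite [RHS]big_mkcond.
by apply: eq_bigr => a _; rewrite addnC.
Qed.

Lemma triangle_inner a (F : nat -> R) : (0 < a < k)%N ->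
  \sum_(1 <= c < k | (a + c < k)%N) F c = \sum_(1 <= c < k - a) F c.
Proof.
move=> ha; have le_ak : (k - a <= k)%N by lia.
rewrite (big_nat_widen _ _ _ _ _ le_ak); apply: eq_bigl => c /=.
by apply/idP/idP; lia.
Qed.

(** The binomials let the sum over a and c factor into two truncated binomial
    expansions; the same happens in [triangle_sum_Q], where the corner
    a + c = k has to be taken out. *)
Lemma triangle_sum_T (x y w : R) n : (0 < n < k - 1)%N ->
  \sum_(1 <= a < k) \sum_(1 <= c < k | (a + c < k)%N)
    x ^+ a * y ^+ (k - a - c) * w ^+ c * (-1) ^+ (k - a - c - 1)
      * ('C(n, a) * 'C(k - 1 - n, c))%:R
  = y * (((x - y) ^+ n - (- y) ^+ n) * ((w - y) ^+ (k - 1 - n) - (- y) ^+ (k - 1 - n))).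
Proof.
move=> hn; have hn1 : (n < k)%N by lia. have hn2 : (k - 1 - n < k)%N by lia.
rewrite -(binomial_tail x (- y) hn1) -(binomial_tail w (- y) hn2).
rewrite mulr_suml mulr_sumr; apply: eq_big_nat => a ha.
rewrite mulr_sumr mulr_sumr big_mkcond; apply: eq_big_nat => c hc.
have [le_an|lt_na] := leqP a n; last first.
  by rewrite bin_small //; case: ifP => _; ring.
have [le_cm|lt_mc] := leqP c (k - 1 - n); last first.
  by rewrite ['C(k - 1 - n, c)]bin_small // muln0; case: ifP => _; ring.
have -> : (a + c < k)%N by lia.
have -> : (k - a - c = (n - a + (k - 1 - n - c)).+1)%N by lia.
rewrite subSS subn0 (exprNn y (n - a)) (exprNn y (k - 1 - n - c)) exprS !exprD natrM.
ring.
Qed.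

Lemma triangle_sum_Q (x y w : R) u : (0 < u < k)%N ->
  \sum_(1 <= a < k) \sum_(1 <= c < k | (a + c < k)%N)
    x ^+ a * (- y) ^+ (k - a - c) * w ^+ c * ('C(u, a)%:R * 'C(k - u, c)%:R)
  = ((x - y) ^+ u - (- y) ^+ u) * ((w - y) ^+ (k - u) - (- y) ^+ (k - u))
    - x ^+ u * w ^+ (k - u).
Proof.
move=> hu; have hu1 : (u < k)%N by lia. have hu2 : (k - u < k)%N by lia.
rewrite -(binomial_tail x (- y) hu1) -(binomial_tail w (- y) hu2).
rewrite mulr_suml.
have -> : x ^+ u * w ^+ (k - u) = \sum_(1 <= a < k) \sum_(1 <= c < k)
    (if (a == u) && (c == k - u)%N then x ^+ u * w ^+ (k - u) else 0).
  rewrite (bigD1_seq u) ?mem_index_iota ?iota_uniq //=.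
  rewrite [X in _ = _ + X]big1 ?addr0 => [|a /negPf ne_au]; last first.
    by rewrite big1 // => c _; rewrite ne_au.
  rewrite (bigD1_seq (k - u)%N) ?mem_index_iota ?iota_uniq //=; last by lia.
  rewrite !eqxx big1 ?addr0 // => c /negPf ne_c; by rewrite ne_c.
rewrite -sumrB; apply: eq_big_nat => a ha.
rewrite mulr_sumr -sumrB big_mkcond; apply: eq_big_nat => c hc.
have [le_au|lt_ua] := leqP a u; last first.
  have -> : (a == u) = false by lia.
  by rewrite bin_small //; case: ifP => _ /=; ring.
have [le_cm|lt_mc] := leqP c (k - u); last first.
  have -> : (c == k - u)%N = false by lia.
  by rewrite ['C(k - u, c)]bin_small // andbF; case: ifP => _; ring.
have [/andP[/eqP eau /eqP ecu]|ne] := boolP ((a == u) && (c == k - u)%N).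
  have -> : (a + c < k)%N = false by lia.
  by rewrite eau ecu !binn !subnn; ring.
have -> : (a + c < k)%N by move: ne; lia.
have -> : (k - a - c = (u - a) + (k - u - c))%N by lia.
by rewrite exprD; ring.
Qed.

(** Insert the formula for z a b c.  The part with T and the unrestricted part
    with Q are computed by [triangle_sum_T] and [triangle_sum_Q]; the last two
    brackets are the end terms of [inner_Q_sum]. *)
Lemma PhiE x y w : Phi x y w =
  y * (T_gf (x - y) (w - y) - T_gf (x - y) (- y) - T_gf (- y) (w - y) + T_gf (- y) (- y))
  + (Q_gf (x - y) (w - y) - Q_gf (x - y) (- y) - Q_gf (- y) (w - y) + Q_gf (- y) (- y)
     - Q_gf x w)
  - (Q_gf x (w - y) - Q_gf x (- y) - Q_gf x w)
  - (Q_gf (x - y) w - Q_gf x w - Q_gf (- y) w).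
Proof.
rewrite -T_gf_split -Q_gf_split mulr_sumr.
have -> : Q_gf x w = \sum_(1 <= u < k) x ^+ u * w ^+ (k - u) * Q u by [].
rewrite -sumrB.
transitivity (\sum_(1 <= a < k) \sum_(1 <= c < k | (a + c < k)%N)
   (\sum_(1 <= n < k - 1) x ^+ a * y ^+ (k - a - c) * w ^+ c * (-1) ^+ (k - a - c - 1)
      * ('C(n, a) * 'C(k - 1 - n, c))%:R * T n
    + \sum_(1 <= u < k) x ^+ a * (- y) ^+ (k - a - c) * w ^+ c
      * ('C(u, a)%:R * 'C(k - u, c)%:R) * Q u
    - x ^+ a * (- y) ^+ (k - a - c) * w ^+ c * ('C(k - a, c)%:R * Q a)
    - x ^+ a * (- y) ^+ (k - a - c) * w ^+ c * ('C(k - c, a)%:R * Q (k - c)%N))).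
  apply: eq_big_nat => a ha; rewrite big_nat_cond [RHS]big_nat_cond.
  apply: eq_bigr => c /andP[hc hac].
  have [a0 b0 c0] : [/\ (0 < a)%N, (0 < k - a - c)%N & (0 < c)%N] by split; lia.
  have abc : (a + (k - a - c) + c)%N = k by lia.
  rewrite z_formula // inner_Q_sum // (exprNn y).
  have -> : (-1) ^+ (a + c) = (-1) ^+ (k - a - c) :> R.
    by rewrite -signr_odd -[RHS]signr_odd; congr (_ ^+ (_ : bool)); lia.
  rewrite [in LHS]mulrDr !mulrBr !mulr_sumr -!addrA.
  apply: (f_equal2 +%R); first by apply: eq_bigr => n _; ring.
  apply: (f_equal2 +%R); first by apply: eq_bigr => n _; ring.
  by apply: (f_equal2 +%R); ring.
under eq_bigr => a _ do rewrite !sumrB big_split /=.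
rewrite !sumrB big_split /=.
have exch (F : nat -> nat -> nat -> R) (G : nat -> R) m :
    \sum_(1 <= a < k) \sum_(1 <= c < k | (a + c < k)%N) \sum_(1 <= n < m) F a c n * G n
  = \sum_(1 <= n < m)
     (\sum_(1 <= a < k) \sum_(1 <= c < k | (a + c < k)%N) F a c n) * G n.
  under eq_bigr => a _ do rewrite exchange_big.
  rewrite exchange_big; apply: eq_bigr => n _; rewrite mulr_suml.
  by apply: eq_bigr => a _; rewrite mulr_suml.
rewrite exch exch.
have e1 : \sum_(1 <= a < k) \sum_(1 <= c < k | (a + c < k)%N)
    x ^+ a * (- y) ^+ (k - a - c) * w ^+ c * ('C(k - a, c)%:R * Q a)
    = Q_gf x (w - y) - Q_gf x (- y) - Q_gf x w.
  rewrite /Q_gf -!sumrB; apply: eq_big_nat => a ha; rewrite triangle_inner //.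
  have ka : (0 < k - a)%N by lia.
  transitivity (x ^+ a * ((w - y) ^+ (k - a) - (- y) ^+ (k - a) - w ^+ (k - a)) * Q a).
    rewrite -(binomial_middle w (- y) ka) mulr_sumr mulr_suml.
    by apply: eq_bigr => c _; ring.
  ring.
have e2 : \sum_(1 <= a < k) \sum_(1 <= c < k | (a + c < k)%N)
    x ^+ a * (- y) ^+ (k - a - c) * w ^+ c * ('C(k - c, a)%:R * Q (k - c)%N)
    = Q_gf (x - y) w - Q_gf x w - Q_gf (- y) w.
  rewrite sum_triangleC [Q_gf (x - y) w]Q_gfC [Q_gf (- y) w]Q_gfC [Q_gf x w]Q_gfC.
  rewrite /Q_gf -!sumrB; apply: eq_big_nat => c hc; rewrite triangle_inner //.
  have kc : (0 < k - c)%N by lia.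
  transitivity (w ^+ c * ((x - y) ^+ (k - c) - (- y) ^+ (k - c) - x ^+ (k - c)) * Q c).
    rewrite -(binomial_middle x (- y) kc) mulr_sumr mulr_suml.
    by apply: eq_bigr => a _; rewrite Q_sym // subnAC; ring.
  ring.
rewrite e1 e2; congr (_ + _ - _ - _).
  by apply: eq_big_nat => n hn; rewrite triangle_sum_T //; ring.
rewrite -sumrB; apply: eq_big_nat => u hu; rewrite triangle_sum_Q //; ring.
Qed.

(** Equal second and third arguments amount to summing over b + c fixed, so this
    is the generating function of the stuffle relations; by reversal the first
    and the third term of the relation contribute equally. *)
Lemma Phi_stuffle x y : Phi x y y *+ 2 + Phi y x y = 0.
Proof.
have e1 : Phi x y y = \sum_(1 <= a < k) x ^+ a * y ^+ (k - a)
    * \sum_(1 <= c < k - a) z a (k - a - c) c.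
  rewrite /Phi; apply: eq_big_nat => a ha; rewrite triangle_inner // mulr_sumr.
  apply: eq_big_nat => c hc; have -> : (k - a = (k - a - c) + c)%N by lia.
  by rewrite addnK exprD; ring.
have e1' : Phi x y y = \sum_(1 <= a < k) x ^+ a * y ^+ (k - a)
    * \sum_(1 <= c < k - a) z (k - a - c)%N c a.
  rewrite e1; apply: eq_big_nat => a ha; congr (_ * _).
  rewrite big_nat_rev; apply: eq_big_nat => c hc /=; rewrite add1n subSS.
  have -> : (k - a - (k - a - c))%N = c by lia.
  by apply/esym/z_rev; lia.
have e2 : Phi y x y = \sum_(1 <= b < k) x ^+ b * y ^+ (k - b)
    * \sum_(1 <= c < k - b) z (k - b - c)%N b c.
  rewrite /Phi sum_triangleC.
  rewrite (eq_big_nat _ _ (F2 := fun c => \sum_(1 <= b < k | (c + b < k)%N)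
     y ^+ (k - c - b) * x ^+ b * y ^+ c * z (k - c - b)%N b c)); last first.
    move=> c hc; rewrite !triangle_inner // [LHS]big_nat_rev.
    apply: eq_big_nat => b hb /=; rewrite add1n subSS.
    have -> : (k - (k - c - b) - c)%N = b by lia.
    by [].
  rewrite sum_triangleC; apply: eq_big_nat => b hb.
  rewrite triangle_inner // mulr_sumr; apply: eq_big_nat => c hc.
  have -> : (k - c - b)%N = (k - b - c)%N by lia.
  have -> : (k - b = (k - b - c) + c)%N by lia.
  by rewrite addnK exprD; ring.
rewrite mulr2n {1}e1 e1' e2 -!big_split; apply: big_nat_eq0 => a ha /=.
rewrite -!mulrDr -!big_split /= big_nat_eq0 ?mulr0 // => c hc.
have abc : (a + (k - a - c) + c)%N = k by lia.
by rewrite -[RHS](@z_stuffle a (k - a - c)%N c); [rewrite addrAC|lia..].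
Qed.

Let exp_k1 (x : R) : x * x ^+ (k - 1) = x ^+ k.
Proof. by rewrite -exprS subn1 prednK //; lia. Qed.

Let odd_k1 : odd (k - 1). Proof. by lia. Qed.

Lemma Phi_xyy x y : Phi x y y = y * T_gf (y - x) y - y ^+ k * T_gf 1 1.
Proof.
rewrite PhiE !subrr !T_gf0r !Q_gf0r !Q_gfNr !Q_gfNl opprK.
have -> : T_gf (x - y) (- y) = - T_gf (y - x) y by rewrite -T_gfN opprB.
by rewrite T_gfN [T_gf y y]T_gf_diag -exp_k1; ring.
Qed.

Lemma Phi_yxy x y : Phi y x y =
  x * (y - x) ^+ (k - 1) * T_gf 1 1 + x * T_gf (x - y) x *+ 2 - x ^+ k * T_gf 1 1
  + ((x - y) ^+ k + x ^+ k + y ^+ k) * Q_gf 1 1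
  - (Q_gf x (x - y) - Q_gf y (x - y) + Q_gf x y) *+ 2.
Proof.
rewrite PhiE.
have t1 : T_gf (y - x) (- x) = - T_gf (x - y) x by rewrite -T_gfN opprB.
have t2 : T_gf (- x) (y - x) = - T_gf (x - y) x by rewrite T_gfC t1.
have q1 : Q_gf (y - x) (- x) = Q_gf x (x - y) by rewrite Q_gfC Q_gfNl -Q_gfNr opprB.
have q2 : Q_gf (- x) (y - x) = Q_gf x (x - y) by rewrite Q_gfC q1.
have q3 : Q_gf y (y - x) = - Q_gf y (x - y) by rewrite -Q_gfNr opprB.
have q4 : Q_gf (y - x) (y - x) = Q_gf (x - y) (x - y).
  by rewrite -(opprB x y) Q_gfNl Q_gfNr opprK.
have q5 : Q_gf y (- x) = - Q_gf x y by rewrite Q_gfNr Q_gfC.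
have q6 : Q_gf (- x) (- x) = Q_gf x x by rewrite Q_gfNr Q_gfNl opprK.
rewrite [Q_gf (y - x) y]Q_gfC [Q_gf (- x) y]Q_gfC t1 t2 q1 q2 q3 q4 q5 q6.
by rewrite T_gfN (T_gf_diag (y - x)) (T_gf_diag x) (Q_gf_diag (x - y)) (Q_gf_diag x)
  (Q_gf_diag y) -(exp_k1 x); ring.
Qed.

(** All terms of [Phi_stuffle] except multiples of T(1,1) are symmetric in x
    and y.  The antisymmetric part of it at x = 2, y = 1 reads
    (2^k - 4) T(1,1) = 0. *)
Lemma T_gf11 : T_gf 1 1 = 0.
Proof.
have rel (x y : R) : ((x ^+ k - y ^+ k) + (x + y) * (y - x) ^+ (k - 1)) * T_gf 1 1 = 0.
  have := Phi_stuffle x y; have := Phi_stuffle y x;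
  rewrite (Phi_xyy x y) (Phi_xyy y x) (Phi_yxy x y) (Phi_yxy y x).
  have sN : (x - y) ^+ (k - 1) = - (y - x) ^+ (k - 1).
    by rewrite -[x - y]opprB exprNn -signr_odd odd_k1 expr1 mulN1r.
  have sE : (x - y) ^+ k = (y - x) ^+ k by rewrite -!exp_k1 sN; ring.
  have q1 : Q_gf y (y - x) = - Q_gf y (x - y) by rewrite -Q_gfNr opprB.
  have q2 : Q_gf x (y - x) = - Q_gf x (x - y) by rewrite -Q_gfNr opprB.
  rewrite sE q1 q2 sN [Q_gf y x]Q_gfC => e1 e2.
  by rewrite -[RHS](subrr (0 : R)) -{1}e2 -e1; ring.
have [m em] : exists m, (2 ^ k - 4 = m.+1)%N.
  exists (2 ^ k - 5)%N; have : (2 ^ 4 <= 2 ^ k)%N by rewrite leq_exp2l.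
  by lia.
apply: (@torsion_free m); rewrite -em -[RHS](rel 2 1) -[LHS]mulr_natl; congr (_ * _).
have -> : 1 - 2 = -1 :> R by ring.
rewrite -(signr_odd _ (k - 1)) odd_k1.
rewrite natrB ?natrX ?expr1n; first by ring.
by have : (2 ^ 2 <= 2 ^ k)%N by rewrite leq_exp2l //; lia.
Qed.

(** Half of [Phi_stuffle]. *)
Lemma stuffle_equation x y :
  y * T_gf (y - x) y + x * T_gf (x - y) x
  = pi * ((x - y) ^+ k + x ^+ k + y ^+ k) + Q_gf x (x - y) - Q_gf y (x - y) + Q_gf x y.
Proof.
apply: subr0_eq; apply: (@torsion_free 1).
by rewrite -[RHS](Phi_stuffle x y) Phi_xyy Phi_yxy T_gf11 -[Q_gf 1 1]opprK -pi_def; ring.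
Qed.

(** The image of P_{u,k-u}.  The value pi of the two boundary coefficients is
    forced: it makes the sum of all [Qh u] zero, without which the generating
    function [Z_gf] would have a term y^k. *)
Definition Qh (u : nat) : R := Q u + pi *+ (u == 1%N) + pi *+ (u == k.-1).

Definition Qh_gf (x y : R) : R := \sum_(1 <= u < k) x ^+ u * y ^+ (k - u) * Qh u.

(** The image of Z_{r,k-r}: the coefficient of x^r y^(k-r) in [Z_gf x y], see
    [ZcoefE]. *)
Definition Zcoef (r : nat) : R := (-1) ^+ r *
  (\sum_(1 <= n < k - 1) 'C(n, r)%:R * T n - \sum_(1 <= u < k) 'C(u, r)%:R * Qh u).

Definition Z_gf (x y : R) : R := Qh_gf (x - y) y - y * T_gf (x - y) (- y).

Lemma Qh_even u : ~~ odd u -> Qh u = 0.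
Proof.
move=> even_u; rewrite /Qh Q_even //.
have -> : (u == 1%N) = false by apply/negbTE; lia.
have -> : (u == k.-1) = false by apply/negbTE; lia.
by rewrite !addr0.
Qed.

Lemma Qh_sym u : (0 < u < k)%N -> Qh (k - u)%N = Qh u.
Proof.
move=> hu; rewrite /Qh Q_sym // addrAC.
have -> : (k - u == 1)%N = (u == k.-1) by lia.
by have -> : (k - u == k.-1)%N = (u == 1)%N by lia.
Qed.

Lemma sum_Qh (c : nat -> R) :
  \sum_(1 <= u < k) c u * Qh u
  = (\sum_(1 <= u < k) c u * Q u) + (c 1%N + c k.-1) * pi.
Proof.
have pick j : (0 < j < k)%N -> \sum_(1 <= u < k) c u * (pi *+ (u == j)) = c j * pi.
  move=> hj; rewrite (bigD1_seq j) ?mem_index_iota ?iota_uniq //= eqxx.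
  by rewrite big1 ?addr0 // => u /negPf->; rewrite mulr0.
rewrite mulrDl -(pick 1%N) -?(pick k.-1); try lia.
by rewrite addrA -!big_split; apply: eq_bigr => u _; rewrite /Qh !mulrDr.
Qed.

Lemma Qh_gfE x y : Qh_gf x y = Q_gf x y + pi * (x * y ^+ (k - 1) + x ^+ (k - 1) * y).
Proof.
rewrite /Qh_gf sum_Qh /= -(subn1 k); have -> : (k - (k - 1))%N = 1%N by lia.
by rewrite !expr1 -/(Q_gf x y); ring.
Qed.

Lemma Qh_gf11 : Qh_gf 1 1 = 0.
Proof.
by rewrite Qh_gfE !expr1n !mulr1 -mulr2n mulr_natr pi_def subrr.
Qed.

Lemma ZcoefE x y : \sum_(0 <= r < k) x ^+ r * y ^+ (k - r) * Zcoef r = Z_gf x y.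
Proof.
have bin_sum u (h : (u < k)%N) :
    \sum_(0 <= r < k) x ^+ r * y ^+ (k - r) * (-1) ^+ r * 'C(u, r)%:R
    = (-1) ^+ u * (x - y) ^+ u * y ^+ (k - u).
  rewrite -exprMn mulN1r opprB exprDn mulr_suml (big_cat_nat (leq0n u.+1) h) /=.
  rewrite [X in _ + X]big_nat_eq0 ?addr0 => [|r hr]; last first.
    by rewrite bin_small ?mulr0 //; lia.
  rewrite big_mkord; apply: eq_bigr => r _; rewrite -mulr_natl (exprNn x).
  have -> : (k - r = (u - r) + (k - u))%N by have := ltn_ord r; lia.
  by rewrite exprD; ring.
have exch m (F : nat -> R) : (m <= k)%N ->
    \sum_(0 <= r < k) x ^+ r * y ^+ (k - r) *
       ((-1) ^+ r * \sum_(1 <= u < m) 'C(u, r)%:R * F u)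
    = \sum_(1 <= u < m) (-1) ^+ u * (x - y) ^+ u * y ^+ (k - u) * F u.
  move=> le_mk; under eq_bigr => r _ do rewrite mulrA mulr_sumr.
  rewrite exchange_big_nat; apply: eq_big_nat => u hu.
  rewrite -bin_sum; last by lia.
  by rewrite mulr_suml; apply: eq_bigr => r _; rewrite mulrA.
rewrite /Zcoef; under eq_bigr => r _ do rewrite mulrBr mulrBr.
rewrite sumrB exch ?leq_subr // exch // /Z_gf addrC -sumrN.
congr (_ + _).
  apply: eq_bigr => u _; have [odd_u|even_u] := boolP (odd u); last first.
    by rewrite Qh_even // !mulr0 oppr0.
  by rewrite -signr_odd odd_u; ring.
rewrite /T_gf mulr_sumr -sumrN; apply: eq_big_nat => n hn.
have -> : (k - n = (k - 1 - n).+1)%N by lia.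
rewrite (exprNn y) exprS -(signr_odd _ (k - 1 - n)).
have -> : odd (k - 1 - n) = ~~ odd n by lia.
by rewrite -signr_odd; case: (odd n); ring.
Qed.

(** The two boundary terms of [Qh] absorb the powers of x, y and x - y multiplied
    by pi in [stuffle_equation]. *)
Lemma Z_gf_stuffle x y : Z_gf x y + Z_gf y x = Qh_gf x y.
Proof.
have t1 : T_gf (x - y) (- y) = - T_gf (y - x) y by rewrite -T_gfN opprB.
have t2 : T_gf (y - x) (- x) = - T_gf (x - y) x by rewrite -T_gfN opprB.
have sE : (y - x) ^+ (k - 1) = - (x - y) ^+ (k - 1).
  by rewrite -(opprB x y) exprNn -signr_odd odd_k1 expr1 mulN1r.
have q2 : Q_gf (y - x) x = - Q_gf x (x - y) by rewrite Q_gfC -Q_gfNr opprB.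
have := stuffle_equation x y; rewrite /Z_gf t1 t2 !Qh_gfE q2 [Q_gf (x - y) y]Q_gfC sE.
rewrite -!exp_k1 => e.
transitivity (y * T_gf (y - x) y + x * T_gf (x - y) x - (Q_gf x (x - y) - Q_gf y (x - y))
   + pi * ((x - y) * y ^+ (k - 1) + (x - y) ^+ (k - 1) * y
           + ((y - x) * x ^+ (k - 1) - (x - y) ^+ (k - 1) * x))); first by ring.
by rewrite e; ring.
Qed.

(** The terms with T cancel, as T(y,-x) = - T(x,-y) by symmetry and parity. *)
Lemma Z_gf_shuffle x y : x * Z_gf (x + y) y + y * Z_gf (x + y) x = (x + y) * Qh_gf x y.
Proof.
have Qh_gfC : Qh_gf y x = Qh_gf x y by rewrite !Qh_gfE Q_gfC; ring.
rewrite /Z_gf addrK [x + y]addrC addrK Qh_gfC.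
have -> : T_gf y (- x) = - T_gf x (- y) by rewrite T_gfC -T_gfN opprK.
ring.
Qed.

Lemma sum_T_eq0 : \sum_(1 <= n < k - 1) T n = 0.
Proof. by rewrite -[RHS]T_gf11; apply: eq_bigr => n _; rewrite !expr1n !mul1r. Qed.

Lemma sum_Qh_eq0 : \sum_(1 <= u < k) Qh u = 0.
Proof. by rewrite -[RHS]Qh_gf11; apply: eq_bigr => n _; rewrite !expr1n !mul1r. Qed.

Lemma Zcoef0 : Zcoef 0 = 0.
Proof.
rewrite /Zcoef [X in _ * (X - _)](_ : _ = 0) ?[X in _ * (_ - X)](_ : _ = 0).
- by rewrite subrr mulr0.
- by rewrite -[RHS]sum_Qh_eq0; apply: eq_bigr => u _; rewrite bin0 mul1r.
by rewrite -[RHS]sum_T_eq0; apply: eq_bigr => u _; rewrite bin0 mul1r.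
Qed.

(** Z_{1,k-1} is zero in the reduced double zeta space, so its image has to be.
    For a symmetric sequence of sum zero the first moment vanishes. *)
Lemma Zcoef1 : Zcoef 1 = 0.
Proof.
have moment m (F : nat -> R) : (forall n, (0 < n < m)%N -> F (m - n)%N = F n) ->
    \sum_(1 <= n < m) F n = 0 -> \sum_(1 <= n < m) 'C(n, 1)%:R * F n = 0.
  move=> F_sym F0; apply: (@torsion_free 1); rewrite mulr2n.
  rewrite [X in _ + X]big_nat_rev -big_split /= -[RHS](mulr0 m%:R) -[in RHS]F0.
  rewrite mulr_sumr; apply: eq_big_nat => n hn; rewrite add1n subSS F_sym //.
  by rewrite -mulrDl -natrD !bin1 subnKC //; lia.
by rewrite /Zcoef (moment _ _ T_sym sum_T_eq0) (moment _ _ Qh_sym sum_Qh_eq0) subrr mulr0.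
Qed.

End GeneratingFunctions.

(** * Coefficients of the functional equations *)

Lemma coef_XnC (R : comNzRingType) n (c : R) i :
  ('X^n * c%:P)`_i = if i == n then c else 0.
Proof. by rewrite coefMC coefXn; case: eqP => _; rewrite ?mul1r ?mul0r. Qed.

Lemma coef_sum_XnC (R : comNzRingType) m N (f : nat -> R) i : (m <= i < N)%N ->
  (\sum_(m <= j < N) 'X^j * (f j)%:P)`_i = f i.
Proof.
move=> hi; rewrite coef_sum (bigD1_seq i) ?mem_index_iota ?iota_uniq //=.
rewrite coef_XnC eqxx big1 ?addr0 // => j; rewrite coef_XnC eq_sym => /negPf.
by move=> ->.
Qed.

Lemma coef_Xsub1_exp (R : comNzRingType) n i :
  (('X - 1 : {poly R}) ^+ n)`_i = (-1) ^+ (n - i) * 'C(n, i)%:R.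
Proof.
rewrite addrC exprDn coef_sum.
have coefE (j : 'I_n.+1) : ((-1) ^+ (n - j) * 'X ^+ j *+ 'C(n, j) : {poly R})`_i
    = if i == j :> nat then (-1) ^+ (n - j) * 'C(n, j)%:R else 0.
  rewrite coefMn -polyC1 -polyCN -polyC_exp coefCM coefXn.
  by case: eqP => _; rewrite ?mulr1 ?mulr0 ?mul0rn // mulr_natr.
under eq_bigr => j _ do rewrite coefE.
have [lt_ni|le_in] := ltnP n i.
  rewrite bin_small // mulr0 big1 // => j _.
  by case: eqP => // e; have := ltn_ord j; lia.
rewrite (bigD1 (Ordinal (le_in : (i < n.+1)%N))) //= eqxx big1 ?addr0 // => j.
by rewrite -val_eqE /= eq_sym => /negPf ->.
Qed.

Lemma coef_signC (R : comNzRingType) (p : {poly R}) m c i :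
  (p * (-1) ^+ m * c%:P)`_i = p`_i * ((-1) ^+ m * c).
Proof.
have -> : p * (-1) ^+ m * c%:P = p * ((-1) ^+ m * c)%:P.
  by rewrite rmorphM rmorphXn rmorphN1 mulrA.
exact: coefMC.
Qed.

Lemma natr_bin_succ (R : comNzRingType) n r :
  r.+1%:R * 'C(n, r.+1)%:R = (n%:R - r%:R) * 'C(n, r)%:R :> R.
Proof.
rewrite -natrM mul_bin_left; have [le_rn|lt_nr] := leqP r n.
  by rewrite natrM natrB.
by rewrite bin_small // mulr0 muln0.
Qed.

Section Coefficients.
Variables (R : comNzRingType) (k : nat) (T Q : nat -> R).
Variables (z : nat -> nat -> nat -> R) (pi : R).
Hypothesis sys : triple_system k T Q z pi.

Let pT n : {poly R} := (T n)%:P.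
Let pQ n : {poly R} := (Q n)%:P.
Let pz a b c : {poly R} := (z a b c)%:P.
Let k_ge4 := ts_ge4 sys.
Let k_even := ts_even sys.

Lemma poly_Q_gf11 : Q_gf k pQ 1 1 = (Q_gf k Q 1 1)%:P.
Proof.
by rewrite /Q_gf rmorph_sum; apply: eq_bigr => u _; rewrite !expr1n !mul1r.
Qed.

(** The system over R is one over polynomials in an indeterminate X as well; the
    functional equations may thus be evaluated at X, X - 1, X + 1 and 1 and
    compared coefficientwise. *)
Lemma poly_system : triple_system k pT pQ pz pi%:P.
Proof.
split; [exact: k_ge4|exact: k_even| | | | | | | | |].
- move=> n p /polyP e; apply/polyP => i; have := e i; rewrite coefMn !coef0.
  exact: ts_torsion sys _ _.
- by move=> n hn; rewrite /pT (ts_T_sym sys).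
- by move=> n hn; rewrite /pQ (ts_Q_sym sys).
- by move=> n hn; rewrite /pQ (ts_Q_even sys).
- by rewrite /pQ (ts_Q1 sys).
- by rewrite poly_Q_gf11 -rmorphMn (ts_pi sys) rmorphN.
- move=> a b c a0 b0 c0 abc; rewrite /pz (ts_formula sys) // rmorphD !rmorphM.
  rewrite !rmorphXn !rmorphN1 !rmorph_sum.
  by congr (_ * _ + _ * _); apply: eq_bigr => n _; rewrite rmorphM rmorph_nat.
- by move=> *; rewrite /pz (ts_rev sys).
by move=> *; rewrite /pz -!rmorphD (ts_stuffle sys) ?rmorph0.
Qed.

Let zc := Zcoef k T Q pi.
Let qh := Qh k Q pi.

Lemma poly_Qh u : Qh k pQ pi%:P u = (qh u)%:P.
Proof. by rewrite /qh /Qh !rmorphD !rmorphMn. Qed.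

Lemma poly_Zcoef r : Zcoef k pT pQ pi%:P r = (zc r)%:P.
Proof.
rewrite /zc /Zcoef rmorphM rmorphXn rmorphN1 rmorphB !rmorph_sum.
congr (_ * (_ - _)); apply: eq_bigr => n _; rewrite rmorphM rmorph_nat //.
by rewrite poly_Qh.
Qed.

Lemma poly_Z_gf x y : Z_gf k pT pQ pi%:P x y
  = \sum_(1 <= r < k) x ^+ r * y ^+ (k - r) * (zc r)%:P.
Proof.
rewrite -(ZcoefE poly_system) big_ltn; last by lia.
rewrite poly_Zcoef /zc (Zcoef0 sys) mulr0 add0r.
by apply: eq_bigr => r _; rewrite poly_Zcoef.
Qed.

Lemma poly_Qh_gf x y : Qh_gf k pQ pi%:P x y
  = \sum_(1 <= r < k) x ^+ r * y ^+ (k - r) * (qh r)%:P.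
Proof. by apply: eq_bigr => r _; rewrite poly_Qh. Qed.

Lemma Zcoef_stuffle r : (0 < r < k)%N -> zc r + zc (k - r)%N = qh r.
Proof.
move=> hr; have := Z_gf_stuffle poly_system 'X 1; rewrite !poly_Z_gf poly_Qh_gf.
have X1 f : \sum_(1 <= r < k) 'X ^+ r * 1 ^+ (k - r) * (f r)%:P
          = \sum_(1 <= r < k) 'X^r * (f r)%:P :> {poly R}.
  by apply: eq_bigr => j _; rewrite expr1n mulr1.
have oneX : \sum_(1 <= r < k) 1 ^+ r * 'X ^+ (k - r) * (zc r)%:P
          = \sum_(1 <= r < k) 'X^r * (zc (k - r)%N)%:P :> {poly R}.
  rewrite [LHS]big_nat_rev; apply: eq_big_nat => j hj /=.
  by rewrite add1n subSS expr1n mul1r subKn //; lia.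
rewrite !X1 oneX => /polyP /(_ r).
by rewrite coefD !(coef_sum_XnC _ hr).
Qed.

(** [Z_gf_shuffle] at (X,1), after cancelling the non-zero-divisors X and X + 1
    from both sides. *)
Lemma Zcoef_shuffle r : (0 < r < k)%N -> qh r =
  \sum_(1 <= a < k) ('C(a.-1, r.-1) + 'C(a.-1, (k - r).-1))%:R * zc a.
Proof.
move=> hr; have := Z_gf_shuffle poly_system 'X 1; rewrite !poly_Z_gf poly_Qh_gf mul1r.
pose L : {poly R} := \sum_(1 <= a < k)
  (('X + 1) ^+ a.-1 * (zc a)%:P + 'X^(k.-1 - a) * ('X + 1) ^+ a.-1 * (zc a)%:P).
pose M : {poly R} := \sum_(1 <= u < k) 'X^(u.-1) * (qh u)%:P.
have eM : \sum_(1 <= u < k) 'X ^+ u * 1 ^+ (k - u) * (qh u)%:P = 'X * M.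
  rewrite mulr_sumr; apply: eq_big_nat => -[//|u] hu.
  by rewrite expr1n mulr1 exprS mulrA.
have eL : 'X * \sum_(1 <= a < k) ('X + 1) ^+ a * 1 ^+ (k - a) * (zc a)%:P
   + \sum_(1 <= a < k) ('X + 1) ^+ a * 'X ^+ (k - a) * (zc a)%:P = ('X + 1) * ('X * L).
  rewrite !mulr_sumr -big_split; apply: eq_big_nat => -[//|a] ha /=.
  have -> : (k - a.+1 = (k.-1 - a.+1).+1)%N by lia.
  by rewrite expr1n !exprS; ring.
rewrite eM eL => e.
have X1_reg : GRing.lreg ('X + 1 : {poly R}).
  by apply: lreg_lead; rewrite -[1]opprK -polyC1 -polyCN lead_coefXsubC; exact: lreg1.
have X_reg : GRing.lreg ('X : {poly R}).
  by apply: lreg_lead; rewrite lead_coefX; exact: lreg1.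
have {e} /polyP /(_ r.-1) : L = M by apply/X_reg/X1_reg.
have -> : M`_r.-1 = qh r.
  rewrite /M big_add1 /=; case: (r) hr => // r' hr'.
  by rewrite (coef_sum_XnC (fun u => qh u.+1)) //=; lia.
move=> <-; rewrite coef_sum; apply: eq_big_nat => a ha.
rewrite coefD !coefMC coef_X1_exp coefXnM coef_X1_exp natrD mulrDl; congr (_ + _ * _).
case: ltnP => h; first by rewrite bin_small //; lia.
by rewrite -bin_sub; [congr ('C(_, _)%:R); lia|lia].
Qed.

(** The coefficient of X^r in [stuffle_equation] at (X,X-1). *)
Lemma stuffle_equation_coef r : (3 <= r)%N -> (r <= k - 3)%N -> odd r ->
  T r.-1 - \sum_(1 <= n < k - 1) 'C(n.+1, r)%:R * T n
  + \sum_(1 <= u < k) 'C(u, r)%:R * Q u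
  + \sum_(1 <= u < k) 'C(u, k - r)%:R * Q u - Q r + 'C(k, r)%:R * pi = 0.
Proof.
move=> r3 rk odd_r.
have hr : (1 <= r < k)%N by lia.
have := stuffle_equation poly_system 'X ('X - 1).
rewrite subKr [_ - 1 - _](_ : _ = -1) ?[T_gf _ _ (-1) _](T_gfC poly_system); last by ring.
rewrite [T_gf _ _ 1 _](T_gfC poly_system) [Q_gf _ _ 'X ('X - 1)](Q_gfC poly_system).
rewrite expr1n => /polyP /(_ r); rewrite !(coefD, coefN, coefCM).
have -> : (('X - 1) * T_gf k pT ('X - 1) (-1))`_r
    = - \sum_(1 <= n < k - 1) 'C(n.+1, r)%:R * T n.
  rewrite /T_gf mulr_sumr coef_sum -sumrN; apply: eq_big_nat => n hn.
  rewrite mulrA mulrA -exprS coef_signC coef_Xsub1_exp; have [lt_nr|le_rn] := ltnP n.+1 r.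
    by rewrite bin_small // !(mul0r, mulr0) oppr0.
  rewrite -(signr_odd _ (n.+1 - r)) -(signr_odd _ (k - 1 - n)).
  have -> : odd (k - 1 - n) = ~~ odd n by lia.
  have -> : odd (n.+1 - r) = odd n by lia.
  by case: (odd n); rewrite /= ?expr0 ?expr1; ring.
have -> : ('X * T_gf k pT 'X 1)`_r = T r.-1.
  have hr1 : (1 <= r.-1 < k - 1)%N by lia.
  have -> : T_gf k pT 'X 1 = \sum_(1 <= n < k - 1) 'X^n * (T n)%:P.
    by apply: eq_bigr => n _; rewrite expr1n mulr1.
  have r0 : (r == 0)%N = false by lia.
  by rewrite coefXM r0; apply: coef_sum_XnC.
have -> : (Q_gf k pQ 'X 1)`_r = Q r.
  have -> : Q_gf k pQ 'X 1 = \sum_(1 <= u < k) 'X^u * (Q u)%:P.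
    by apply: eq_bigr => n _; rewrite expr1n mulr1.
  exact: coef_sum_XnC.
have -> : (Q_gf k pQ ('X - 1) 1)`_r = \sum_(1 <= u < k) 'C(u, r)%:R * Q u.
  rewrite /Q_gf coef_sum; apply: eq_big_nat => u hu.
  rewrite expr1n mulr1 coefMC coef_Xsub1_exp.
  have [odd_u|even_u] := boolP (odd u); last by rewrite (ts_Q_even sys) // !mulr0.
  have [lt_ur|le_ru] := ltnP u r; first by rewrite bin_small // !(mul0r, mulr0).
  rewrite -(signr_odd _ (u - r)); have -> : odd (u - r) = false by lia.
  by rewrite expr0 mul1r.
have -> : (Q_gf k pQ ('X - 1) 'X)`_r = - \sum_(1 <= u < k) 'C(u, k - r)%:R * Q u.
  rewrite /Q_gf coef_sum -sumrN; apply: eq_big_nat => u hu.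
  rewrite coefMC coefMXn coef_Xsub1_exp.
  have [odd_u|even_u] := boolP (odd u); last by rewrite (ts_Q_even sys) // !mulr0 oppr0.
  case: ltnP => h; first by rewrite ['C(u, k - r)]bin_small ?mul0r ?oppr0 //; lia.
  have h1 : (k - r <= u)%N by lia.
  rewrite -(bin_sub h1); have -> : (u - (k - r) = r - (k - u))%N by lia.
  rewrite -(signr_odd _ (u - _)); have -> : odd (u - (r - (k - u))) by lia.
  by rewrite expr1 mulN1r mulNr.
rewrite coef1 coefXn coef_Xsub1_exp -(signr_odd _ (k - r)).
have -> : (r == 0)%N = false by lia. have -> : (r == k)%N = false by lia.
have -> : odd (k - r) by lia.
rewrite !mulr0n expr1 => /eqP; rewrite -subr_eq0 => /eqP e.
by apply: etrans e; ring.
Qed.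

Lemma sum_bin_succ N (F : nat -> R) r :
  r.+1%:R * (\sum_(1 <= n < N) 'C(n, r.+1)%:R * F n)
  = (\sum_(1 <= n < N) n%:R * 'C(n, r)%:R * F n)
    - r%:R * (\sum_(1 <= n < N) 'C(n, r)%:R * F n).
Proof.
rewrite !mulr_sumr -sumrB; apply: eq_bigr => n _.
by rewrite mulrA natr_bin_succ; ring.
Qed.

Lemma sum_bin_compl N m (F : nat -> R) r : (N <= m.+1)%N ->
  \sum_(1 <= n < N) 'C(n, r)%:R * (m - n)%:R * F n
  = m%:R * (\sum_(1 <= n < N) 'C(n, r)%:R * F n)
    - (\sum_(1 <= n < N) n%:R * 'C(n, r)%:R * F n).
Proof.
move=> le_Nm; rewrite !mulr_sumr -sumrB; apply: eq_big_nat => n hn.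
by rewrite natrB; [ring|lia].
Qed.

Lemma formula_last1 a b : (0 < a)%N -> (0 < b)%N -> (a + b + 1)%N = k ->
  z a b 1 = (-1) ^+ (b - 1) *
    ((\sum_(1 <= n < k - 1) 'C(n, a)%:R * (k - 1 - n)%:R * T n)
     - (\sum_(1 <= u < k) 'C(u, a)%:R * (k - u)%:R * Q u) + (k - a)%:R * Q a).
Proof.
move=> a0 b0 ab; have c0 : (0 < 1)%N by [].
rewrite (ts_formula sys a0 b0 c0 ab) (inner_Q_sum sys) // !bin1.
have -> : Q (k - 1)%N = 0 by rewrite (ts_Q_sym sys) ?(ts_Q1 sys) //; lia.
have -> : (-1) ^+ (a + 1) = - (-1) ^+ (b - 1) :> R.
  rewrite -signr_odd -[in RHS]signr_odd.
  have -> : odd (a + 1) = ~~ odd (b - 1) by lia.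
  by case: odd; rewrite /= ?expr1 ?expr0 ?opprK.
have -> : \sum_(1 <= n < k - 1) ('C(n, a) * 'C(k - 1 - n, 1))%:R * T n
        = \sum_(1 <= n < k - 1) 'C(n, a)%:R * (k - 1 - n)%:R * T n.
  by apply: eq_bigr => n _; rewrite natrM bin1.
have -> : \sum_(1 <= u < k) 'C(u, a)%:R * 'C(k - u, 1)%:R * Q u
        = \sum_(1 <= u < k) 'C(u, a)%:R * (k - u)%:R * Q u.
  by apply: eq_bigr => u _; rewrite bin1.
ring.
Qed.

(** The left-hand side is the image of 2 H_{r,k-r} without rs (Z_{r,s} + Z_{s,r}),
    which is rs Q_r.  Expanded in T and Q, the two sides differ by
    [stuffle_equation_coef] and by multiples of the recursion
    (r+1) C(n,r+1) = (n-r) C(n,r). *)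
Lemma Zcoef_H r : (3 <= r)%N -> (r <= k - 3)%N -> odd r ->
  - (r%:R - 1) * zc r + ((k - r)%:R - 1) * zc (k - r)%N
  + ((k - r)%:R + 1) * zc (k - r).+1 - (r%:R + 1) * zc r.+1
  + \sum_(1 <= l < k) ('C(k - l, k - r)%:R - 'C(k - l, r)%:R) * Q l
  = - T r.-1 - z r (k - r).-1 1 - z r.-1 (k - r) 1.
Proof.
move=> r3 rk odd_r; have [r' er] : exists r', r = r'.+1 by exists r.-1; lia.
have hr : (0 < r < k)%N by lia.
have -> : zc (k - r)%N = Q r - zc r.
  have -> : Q r = qh r.
    rewrite /qh /Qh; have -> : (r == 1)%N = false by lia.
    have -> : (r == k.-1)%N = false by lia.
    by rewrite !addr0.
  by rewrite -(Zcoef_stuffle hr) addrAC subrr add0r.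
have -> : zc (k - r).+1 = - zc r.-1.
  have hr1 : (0 < r.-1 < k)%N by lia.
  have := Zcoef_stuffle hr1; rewrite /qh (Qh_even sys); last by lia.
  have -> : (k - r.-1)%N = (k - r).+1 by lia.
  by move=> /eqP; rewrite addrC addr_eq0 => /eqP.
have compl j :
    \sum_(1 <= l < k) 'C(k - l, j)%:R * Q l = \sum_(1 <= l < k) 'C(l, j)%:R * Q l.
  rewrite [LHS]big_nat_rev; apply: eq_big_nat => l hl /=.
  by rewrite add1n subSS subKn ?(ts_Q_sym sys) //; lia.
have -> : \sum_(1 <= l < k) ('C(k - l, k - r)%:R - 'C(k - l, r)%:R) * Q l
   = \sum_(1 <= l < k) 'C(l, k - r)%:R * Q l - \sum_(1 <= l < k) 'C(l, r)%:R * Q l.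
  by rewrite -(compl (k - r)%N) -(compl r) -sumrB; apply: eq_bigr => l _; rewrite mulrBl.
have [b10 b20] : (0 < (k - r).-1)%N /\ (0 < k - r)%N by lia.
have r10 : (0 < r.-1)%N by lia. have r0 : (0 < r)%N by lia.
rewrite (formula_last1 r0 b10) ?(formula_last1 r10 b20); try lia.
have -> : (-1) ^+ ((k - r).-1 - 1) = -1 :> R.
  by rewrite -signr_odd; have -> : odd ((k - r).-1 - 1) by lia.
have -> : (-1) ^+ (k - r - 1) = 1 :> R.
  by rewrite -signr_odd; have -> : odd (k - r - 1) = false by lia.
have -> : Q r.-1 = 0 by apply: (ts_Q_even sys); lia.
have E := stuffle_equation_coef r3 rk odd_r.
rewrite /zc /Zcoef !(sum_Qh sys).
have -> : (-1) ^+ r = -1 :> R by rewrite -signr_odd odd_r.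
have -> : (-1) ^+ r.-1 = 1 :> R by rewrite -signr_odd; have -> : odd r.-1 = false by lia.
have -> : (-1) ^+ r.+1 = 1 :> R by rewrite -signr_odd /= odd_r.
rewrite !sum_bin_compl; try lia.
have sumS : \sum_(1 <= n < k - 1) 'C(n.+1, r)%:R * T n
    = \sum_(1 <= n < k - 1) 'C(n, r)%:R * T n
      + \sum_(1 <= n < k - 1) 'C(n, r.-1)%:R * T n.
  by rewrite er -big_split; apply: eq_bigr => n _; rewrite binS natrD mulrDl.
have eCk : 'C(k, r) = ('C(k.-1, r) + 'C(k.-1, r.-1))%N.
  by rewrite er /= -binS prednK //; lia.
have b1 j : (1 < j)%N -> 'C(1, j) = 0%N by move=> h; rewrite bin_small.
rewrite (b1 r) ?(b1 r.-1) ?(b1 r.+1); try lia.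
move: E; rewrite sumS eCk natrD !natrB; try lia.
have t1 N F := sum_bin_succ N F r.-1; have t2 N F := sum_bin_succ N F r.
have c1 := natr_bin_succ R k.-1 r.-1; have c2 := natr_bin_succ R k.-1 r.
have er1 : r.-1.+1 = r by lia.
have kR : k%:R = k.-1%:R + 1 :> R by rewrite natr1 prednK //; lia.
have rR : r%:R = r.-1%:R + 1 :> R by rewrite natr1 er1.
have {t1} t1 N (F : nat -> R) : r%:R * (\sum_(1 <= n < N) 'C(n, r)%:R * F n)
  - (\sum_(1 <= n < N) n%:R * 'C(n, r.-1)%:R * F n)
  + r.-1%:R * (\sum_(1 <= n < N) 'C(n, r.-1)%:R * F n) = 0.
  by move: (t1 N F); rewrite er1 => ->; ring.
have {t2} t2 N (F : nat -> R) : (r%:R + 1) * (\sum_(1 <= n < N) 'C(n, r.+1)%:R * F n)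
  - (\sum_(1 <= n < N) n%:R * 'C(n, r)%:R * F n)
  + r%:R * (\sum_(1 <= n < N) 'C(n, r)%:R * F n) = 0.
  by rewrite natr1 (t2 N F); ring.
have {c1} c1 : r%:R * 'C(k.-1, r)%:R - (k.-1%:R - r.-1%:R) * 'C(k.-1, r.-1)%:R = 0 :> R.
  by rewrite -c1 er1 subrr.
have {c2} c2 : (r%:R + 1) * 'C(k.-1, r.+1)%:R - (k.-1%:R - r%:R) * 'C(k.-1, r)%:R = 0 :> R.
  by rewrite natr1 c2 subrr.
move: (t1 (k - 1)%N T) (t2 (k - 1)%N T) (t1 k Q) (t2 k Q) c1 c2.
set t1T := (X in X = 0 -> _) => e1; set t2T := (X in X = 0 -> _) => e2.
set t1Q := (X in X = 0 -> _) => e3; set t2Q := (X in X = 0 -> _) => e4.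
set c1l := (X in X = 0 -> _) => e5; set c2l := (X in X = 0 -> _) => e6.
set El := (X in X = 0 -> _) => e7.
(* The recursion removes the weights n that [formula_last1] brings in, and it
   does the same for the values of the binomials at k-1, which come from the
   boundary term of [Qh]. *)
apply: subr0_eq; transitivity (El - t2T + t1T + t2Q - t1Q + (c2l - c1l) * pi); last first.
  by rewrite e1 e2 e3 e4 e5 e6 e7; ring.
by rewrite /El /t2T /t1T /t2Q /t1Q /c1l /c2l kR rR; ring.
Qed.

(** The definition of [Z_gf], solved for T by the substitution x -> x + y. *)
Lemma T_Zcoef n : (0 < n < k - 1)%N ->
  T n = (-1) ^+ n.+1 * (qh n - \sum_(1 <= r < k) 'C(r, n)%:R * zc r).
Proof.
move=> hn; have hn' : (1 <= n < k)%N by lia.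
have e : Z_gf k pT pQ pi%:P ('X + 1) 1 = Qh_gf k pQ pi%:P 'X 1 - T_gf k pT 'X (-1).
  by rewrite /Z_gf addrK mul1r.
move: e => /polyP /(_ n); rewrite poly_Z_gf coefB poly_Qh_gf.
have -> : \sum_(1 <= r < k) 'X ^+ r * 1 ^+ (k - r) * (qh r)%:P
        = \sum_(1 <= r < k) 'X^r * (qh r)%:P :> {poly R}.
  by apply: eq_bigr => j _; rewrite expr1n mulr1.
have -> : T_gf k pT 'X (-1) = \sum_(1 <= j < k - 1) 'X^j * ((-1) ^+ (k - 1 - j) * T j)%:P.
  by apply: eq_bigr => j _; rewrite rmorphM rmorphXn rmorphN1 mulrA.
rewrite (coef_sum_XnC _ hn') (coef_sum_XnC (fun j => (-1) ^+ (k - 1 - j) * T j) hn).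
have -> : (\sum_(1 <= r < k) ('X + 1) ^+ r * 1 ^+ (k - r) * (zc r)%:P)`_n
        = \sum_(1 <= r < k) 'C(r, n)%:R * zc r.
  by rewrite coef_sum; apply: eq_bigr => r _; rewrite expr1n mulr1 coefMC coef_X1_exp.
move=> ->; rewrite opprB addrCA subrr addr0 mulrA -exprD.
rewrite -signr_odd; have -> : odd (n.+1 + (k - 1 - n)) = false by lia.
by rewrite expr0 mul1r.
Qed.

End Coefficients.

(** * Linear maps out of quotients by spans *)

Lemma quot_lift (K : nzRingType) (V W : lmodType K) (G : V -> Prop) (f : V -> W) :
  linear f -> (forall v, G v -> f v = 0) ->
  exists g : {linear quot_mod G -> W}, forall v, g (quot_pi G v) = f v.
Proof.
move=> f_lin fG; pose fM := GRing.isLinear.Build K V W *:%R f f_lin.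
pose fL : {linear V -> W} := HB.pack f fM.
have fLZ a v : fL (a *: v) = a *: fL v by exact: linearZ.
have f0 v : v \in lspan G -> fL v = 0.
  move=> /lspanP[s Gs ->]; rewrite raddf_sum big_seq big1 // => p /Gs Gp.
  by rewrite [LHS]fLZ [fL _]fG ?scaler0.
pose g (x : quot_mod G) := fL (repr x).
have gE v : g (quot_pi G v) = fL v.
  apply: subr0_eq; rewrite /g -raddfB; apply: f0.
  by apply/quot_piP; rewrite quot_reprK.
have g_lin : linear g.
  move=> a x y; rewrite -[x]quot_reprK -[y]quot_reprK -linearP !gE.
  exact: linearP.
pose gM := GRing.isLinear.Build K (quot_mod G) W *:%R g g_lin.
by exists (HB.pack g gM : {linear quot_mod G -> W}).
Qed.

Lemma linear_eq_lspan (K : nzRingType) (V W : lmodType K) (G : V -> Prop)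
    (f h : {linear V -> W}) v :
  (forall x, G x -> f x = h x) -> v \in lspan G -> f v = h v.
Proof.
move=> fh /lspanP[s Gs ->]; rewrite !raddf_sum; apply: eq_big_seq => p /Gs Gp.
have fZ a x : f (a *: x) = a *: f x by exact: linearZ.
have hZ a x : h (a *: x) = a *: h x by exact: linearZ.
by rewrite [LHS]fZ [RHS]hZ fh.
Qed.

(** * The map from the double zeta space to the formal algebra *)

Section Construction.
Variable k : nat.
Hypotheses (k_ge4 : (4 <= k)%N) (k_even : ~~ odd k).
Hypothesis zeta_formula : forall a b c : nat,
  (1 <= a)%N -> (1 <= b)%N -> (1 <= c)%N -> (a + b + c)%N = k ->
  zetaAf [:: a; b; c] =
    (-1) ^+ (b - 1)%N *: \sum_(1 <= n < k - 1)
        ('C(n, a) * 'C((k - 1 - n)%N, c))%N%:R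
          *: zetaAf [:: n; 1%N; (k - 1 - n)%N]
    + (-1) ^+ (a + c)%N *: \sum_(1 <= i < b)
        ('C((a + i)%N, a) * 'C((b + c - i)%N, c))%N%:R
          *: (zf (a + i)%N * zf (b + c - i)%N).

Definition zeta_n1m n : ZAf := zeta3 n 1 (k - 1 - n).
Definition zf_prod u : ZAf := zf u * zf (k - u).
(** The constant pi of the functional equation. *)
Definition edge_value : ZAf := - (2^-1 *: Q_gf k zf_prod 1 1).

Lemma zeta3E a b c : (0 < a)%N -> (0 < b)%N -> (0 < c)%N ->
  zetaAf [:: a; b; c] = zeta3 a b c.
Proof. by move=> a0 b0 c0; rewrite zetaAfE //= a0 b0 c0. Qed.

Lemma scale_signZ n (v : ZAf) : (-1) ^+ n *: v = (-1) ^+ n * v.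
Proof. by rewrite -signr_odd scaler_sign -signr_odd mulr_sign. Qed.

Lemma scale_natZ n (v : ZAf) : n%:R *: v = n%:R * v.
Proof. by rewrite scaler_nat mulr_natl. Qed.

Lemma zeta_system :
  triple_system k zeta_n1m zf_prod (fun a b c => zeta3 a b c) edge_value.
Proof.
split; [exact: k_ge4|exact: k_even|exact: mulrn_inj0| | | | | | | |].
- move=> n hn; rewrite /zeta_n1m subKn; last by lia.
  have [n0 m0] : (0 < n)%N /\ (0 < k - 1 - n)%N by lia.
  have := @zeta3_rev n 1 (k - 1 - n) n0 isT m0.
  have -> : odd (n + 1 + (k - 1 - n)) = false by lia.
  by rewrite mul1r.
- by move=> u hu; rewrite /zf_prod subKn; [exact: mulrC|lia].
- by move=> u even_u; rewrite /zf_prod zf_even ?mul0r.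
- by rewrite /zf_prod zf_1 mul0r.
- by rewrite /edge_value mulNrn -scaler_nat scalerA divff ?scale1r.
- move=> a b c a0 b0 c0 abc; rewrite -zeta3E // zeta_formula //.
  rewrite !scale_signZ; congr (_ * _ + _ * _); apply: eq_big_nat => n hn.
    by rewrite scale_natZ /zeta_n1m zeta3E //; lia.
  rewrite scale_natZ /zf_prod; congr (_ * (_ * zf _)); lia.
- move=> a b c a0 b0 c0 abc; rewrite (zeta3_rev a0 b0 c0) abc.
  by rewrite (negPf k_even) mul1r.
move=> a b c a0 b0 c0 abc.
have e1 : zeta2 (a + b) c = 0 by apply: zeta2_even; lia.
have e2 : zeta2 b (a + c) = 0 by apply: zeta2_even; lia.
have := stuffle12 (posn a) (posn b) (posn c).
by rewrite !add_posn // zeta1_eq0 // mul0r e1 e2 !addr0 => <-.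
Qed.

Definition beta_Z := Zcoef k zeta_n1m zf_prod edge_value.
Definition beta_P := Qh k zf_prod edge_value.

Definition symbol_image (i : dz_symbol k) : ZAf :=
  match i with
  | inl (inl p) => beta_Z (val p).1
  | inl (inr p) => beta_P (val p).1
  | inr _ => 0
  end.

Lemma image_freeZ r s : (0 < r)%N -> (0 < s)%N -> (r + s = k)%N ->
  lin_ext symbol_image (freeZ k r s) = beta_Z r.
Proof.
move=> r0 s0 rs.
have h : [&& (0 < (r, s).1)%N, (0 < (r, s).2)%N & ((r, s).1 + (r, s).2 == k)%N].
  by rewrite /= r0 s0 rs eqxx.
by rewrite /freeZ insubT lin_extU.
Qed.

Lemma image_freeP r s : (0 < r)%N -> (0 < s)%N -> (r + s = k)%N ->
  lin_ext symbol_image (Defs.freeP k r s) = beta_P r.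
Proof.
move=> r0 s0 rs.
have h : [&& (0 < (r, s).1)%N, (0 < (r, s).2)%N & ((r, s).1 + (r, s).2 == k)%N].
  by rewrite /= r0 s0 rs eqxx.
by rewrite /Defs.freeP insubT lin_extU.
Qed.

(** The defining relations hold by [Zcoef_stuffle] and [Zcoef_shuffle].  Of the
    elements divided out, P_{r,s} with r, s even goes to zero because
    zf vanishes at even arguments, and Z_{1,k-1} does so by [Zcoef1]. *)
Lemma dzt_map : exists g : {linear dzt_space k -> ZAf},
  (forall r s, (0 < r)%N -> (0 < s)%N -> (r + s = k)%N -> g (dztZ k r s) = beta_Z r) /\
  (forall r s, (0 < r)%N -> (0 < s)%N -> (r + s = k)%N -> g (dztP k r s) = beta_P r).
Proof.
have f_lin := lin_ext_is_linear symbol_image.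
pose fM := GRing.isLinear.Build rat {malg rat[dz_symbol k]} ZAf *:%R _ f_lin.
pose f : {linear {malg rat[dz_symbol k]} -> ZAf} := HB.pack (lin_ext symbol_image) fM.
have fZ r s : (0 < r)%N -> (0 < s)%N -> (r + s = k)%N -> f (freeZ k r s) = beta_Z r.
  exact: image_freeZ.
have fP r s : (0 < r)%N -> (0 < s)%N -> (r + s = k)%N -> f (Defs.freeP k r s) = beta_P r.
  exact: image_freeP.
have fk : f (freeZk k) = 0 by exact: lin_extU.
have fB u v : f (u - v) = f u - f v by exact: raddfB.
have fD u v : f (u + v) = f u + f v by exact: raddfD.
have fN (n : nat) v : f (n%:R *: v) = n%:R * f v.
  by rewrite -scale_natZ; exact: linearZ.
have frel v : dz_relator v -> f v = 0.
  move=> [r [s [r0 s0 rs [->|->]]]]; rewrite fB (fP r s) //.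
    have sr : (s + r)%N = k by rewrite addnC.
    have hr : (0 < r < k)%N by lia.
    have st : beta_Z r + beta_Z s = beta_P r.
      have -> : s = (k - r)%N by lia.
      exact: (Zcoef_stuffle zeta_system hr).
    by rewrite !fD fk addr0 (fZ r s) // (fZ s r) // st subrr.
  have hr : (0 < r < k)%N by lia.
  have -> : beta_P r = \sum_(1 <= a < k) ('C(a.-1, r.-1) + 'C(a.-1, s.-1))%:R * beta_Z a.
    have -> : s = (k - r)%N by lia.
    exact: (Zcoef_shuffle zeta_system hr).
  rewrite (big_morph f fD (raddf0 f)) -sumrB; apply: big_nat_eq0 => a ha.
  have [a0 b0 ab] : [/\ (0 < a)%N, (0 < k - a)%N & (a + (k - a))%N = k] by split; lia.
  by rewrite fN (fZ a (k - a)%N) // subrr.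
have [g1 g1E] := quot_lift f_lin frel.
have g1rel v : dzt_relator v -> g1 v = 0.
  case=> [->|->|[r [s [/andP[r0 er] /andP[s0 es] rs ->]]]]; rewrite g1E.
  - exact: fk.
  - have k1 : (0 < k.-1)%N by lia.
    by rewrite [LHS]fZ //; [exact: (Zcoef1 zeta_system)|lia].
  by rewrite [LHS]fP // /beta_P (Qh_even zeta_system).
have [g2 g2E] := quot_lift (@linearP _ _ _ _ g1) g1rel.
exists g2; split=> r s r0 s0 rs; rewrite g2E g1E; [exact: fZ|exact: fP].
Qed.

(** * Values on H, and the image *)

Variable g : {linear dzt_space k -> ZAf}.
Hypothesis gZ : forall r s, (0 < r)%N -> (0 < s)%N -> (r + s = k)%N ->
  g (dztZ k r s) = beta_Z r.
Hypothesis gP : forall r s, (0 < r)%N -> (0 < s)%N -> (r + s = k)%N ->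
  g (dztP k r s) = beta_P r.

Let gD u v : g (u + v) = g u + g v. Proof. exact: raddfD. Qed.
Let gN u : g (- u) = - g u. Proof. exact: raddfN. Qed.
Let gS a v : g (a *: v) = a *: g v. Proof. exact: linearZ. Qed.

Lemma beta_P_inner u : (1 < u < k.-1)%N -> beta_P u = zf_prod u.
Proof.
move=> hu; rewrite /beta_P /Qh; have -> : (u == 1)%N = false by lia.
have -> : (u == k.-1)%N = false by lia.
by rewrite !mulr0n !addr0.
Qed.

(** The product of double values in [zeta4_parity] is here
    zeta(1,r-1) zeta(s-1,1) = - rs zf(r) zf(s); the triple values are those of
    [Zcoef_H]. *)
Lemma zeta4_H r s : (3 <= r)%N -> (3 <= s)%N -> odd r -> odd s -> (r + s = k)%N ->
  zeta4 r.-1 1 s.-1 1 *+ 2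
  = (r%:R * s%:R) * zf_prod r + (- zeta_n1m r.-1 - zeta3 r s.-1 1 - zeta3 r.-1 s 1).
Proof.
move=> r3 s3 odd_r odd_s rs.
have [r0 s0] : (0 < r.-1)%N /\ (0 < s.-1)%N by lia.
have [r2 s2] : (2 <= r)%N /\ (2 <= s)%N by lia.
have even_s : ~~ odd (r.-1 + 1 + s.-1 + 1) by lia.
rewrite zeta4_parity // addn1 add1n addn1 !prednK; try lia.
have -> : zeta2 1 r.-1 = - zeta2 r.-1 1 by apply: zeta2_odd; lia.
rewrite !zeta2_last1 // /zf_prod /zeta_n1m; have -> : (k - r)%N = s by lia.
have -> : (k - 1 - r.-1)%N = s by lia.
by rewrite !scale_natZ; ring.
Qed.

Lemma g_H r s : (3 <= r)%N -> (3 <= s)%N -> odd r -> odd s -> (r + s = k)%N ->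
  g (dztH k r s) = zeta4 r.-1 1 s.-1 1.
Proof.
move=> r3 s3 odd_r odd_s rs.
have es : s = (k - r)%N by lia. have rk : (r <= k - 3)%N by lia.
have [r0 s0] : (0 < r)%N /\ (0 < s)%N by lia.
have sr : (s + r)%N = k by rewrite addnC.
have gsum : g (Hsum k r s) =
    \sum_(1 <= l < k) ('C(k - l, k - r)%:R - 'C(k - l, r)%:R) * zf_prod l.
  rewrite (big_morph g gD (raddf0 g)) -es.
  have h3 : (1 <= 3)%N by []. have h4 : (k - 2 <= k)%N by lia.
  rewrite (big_nat_widenl _ _ _ _ _ h3) (big_nat_widen _ _ _ _ _ h4) big_mkcond.
  apply: eq_big_nat => l hl; have [l0 kl0] : (0 < l)%N /\ (0 < k - l)%N by lia.
  have lk : (l + (k - l))%N = k by lia.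
  case: ifP => hc.
    by rewrite gS gP // beta_P_inner ?scalerBl ?scale_natZ ?mulrBl //; lia.
  have [odd_l|even_l] := boolP (odd l); last first.
    by rewrite (ts_Q_even zeta_system) ?mulr0.
  have [l1|lk1] : l = 1%N \/ l = (k - 1)%N by lia.
    by rewrite l1 (ts_Q1 zeta_system) mulr0.
  by rewrite lk1 (ts_Q_sym zeta_system) ?(ts_Q1 zeta_system) ?mulr0 //; lia.
have := Zcoef_H zeta_system r3 rk odd_r; rewrite -gsum -es => eH.
have hr : (0 < r < k)%N by lia.
have := Zcoef_stuffle zeta_system hr; rewrite -es -/(beta_P r) beta_P_inner; last by lia.
move=> est.
rewrite dztHE gS !gD gN !gS.
have [s10 r10] : (0 < s.+1)%N /\ (0 < r.-1)%N by lia.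
have [r20 s20] : (0 < r.+1)%N /\ (0 < s.-1)%N by lia.
rewrite (gZ r0 s0 rs) (gZ s0 r0 sr) (gZ s10 r10) ?(gZ r20 s20); try lia.
have n1 (a : nat) (v : ZAf) : (a%:R + 1 : rat) *: v = (a%:R + 1) * v.
  by rewrite scalerDl scale1r scale_natZ mulrDl mul1r.
have n2 (v : ZAf) : (r%:R * s%:R - r%:R + 1 : rat) *: v = (r%:R * s%:R - r%:R + 1) * v.
  by rewrite scalerDl scalerBl scale1r -natrM !scale_natZ natrM; ring.
have n3 (v : ZAf) : (r%:R * s%:R + s%:R - 1 : rat) *: v = (r%:R * s%:R + s%:R - 1) * v.
  by rewrite scalerBl scalerDl scale1r -natrM !scale_natZ natrM; ring.
rewrite !n1 n2 n3.
have <- : 2^-1 *: (zeta4 r.-1 1 s.-1 1 *+ 2) = zeta4 r.-1 1 s.-1 1.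
  by rewrite -scaler_nat scalerA mulVf ?scale1r.
congr (_ *: _); rewrite zeta4_H // -est.
move: eH; rewrite -/(beta_Z r) -/(beta_Z s) -/(beta_Z s.+1) -/(beta_Z r.+1) => <-.
ring.
Qed.

Definition in_image (v : ZAf) := exists d, g d = v.

Lemma image0 : in_image 0. Proof. by exists 0; exact: raddf0. Qed.

Lemma imageD u v : in_image u -> in_image v -> in_image (u + v).
Proof. by move=> [c <-] [d <-]; exists (c + d); exact: gD. Qed.

Lemma imageZ a v : in_image v -> in_image (a *: v).
Proof. by move=> [d <-]; exists (a *: d); exact: gS. Qed.

Lemma imageN v : in_image v -> in_image (- v).
Proof. by rewrite -scaleN1r; apply: imageZ. Qed.

Lemma image_nat (n : nat) v : in_image v -> in_image (n%:R * v).
Proof. by rewrite -scale_natZ; apply: imageZ. Qed.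

Lemma image_sign n v : in_image v -> in_image ((-1) ^+ n * v).
Proof. by rewrite -scale_signZ; apply: imageZ. Qed.

Lemma image_sum m n (F : nat -> ZAf) :
  (forall i, (m <= i < n)%N -> in_image (F i)) -> in_image (\sum_(m <= i < n) F i).
Proof.
move=> imF; rewrite big_nat_cond; apply: big_ind => [||i /andP[/imF]] //.
  exact: image0.
exact: imageD.
Qed.

Lemma image_beta_P u : (0 < u < k)%N -> in_image (beta_P u).
Proof. by move=> hu; exists (dztP k u (k - u)%N); apply: gP; lia. Qed.

(** At the two boundary indices P goes to pi rather than to Q_u, but there
    Q_u = 0 because zf(1) = 0. *)
Lemma image_Q u : (0 < u < k)%N -> in_image (zf_prod u).
Proof.
move=> hu; have [hu'|hu'] := boolP (1 < u < k.-1)%N.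
  by rewrite -beta_P_inner //; apply: image_beta_P.
suff -> : zf_prod u = 0 by exact: image0.
have [->|->] : u = 1%N \/ u = (k - 1)%N by lia.
  exact: ts_Q1 zeta_system.
by rewrite (ts_Q_sym zeta_system) ?(ts_Q1 zeta_system) //; lia.
Qed.

Lemma image_T n : (0 < n < k - 1)%N -> in_image (zeta_n1m n).
Proof.
move=> hn; rewrite (T_Zcoef zeta_system hn); apply/image_sign/imageD.
  by apply: image_beta_P; lia.
apply/imageN/image_sum => r hr; apply: image_nat.
by exists (dztZ k r (k - r)%N); apply: gZ; lia.
Qed.

Lemma image_z3 a b c : (0 < a)%N -> (0 < b)%N -> (0 < c)%N -> (a + b + c)%N = k ->
  in_image (zeta3 a b c).
Proof.
move=> a0 b0 c0 abc; rewrite (ts_formula zeta_system a0 b0 c0 abc).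
apply: imageD; apply: image_sign; apply: image_sum => i hi; apply: image_nat.
  exact: image_T.
by apply: image_Q; lia.
Qed.

Lemma image_z4 a b c d : (0 < a)%N -> (0 < b)%N -> (0 < c)%N -> (0 < d)%N ->
  (a + b + c + d)%N = k -> in_image (zeta4 a b c d).
Proof.
move=> a0 b0 c0 d0 abcd.
have -> : zeta4 a b c d = 2^-1 *: (zeta4 a b c d *+ 2).
  by rewrite -scaler_nat scalerA mulVf ?scale1r.
apply: imageZ; rewrite zeta4_parity ?abcd //; apply: imageD; apply: imageN.
  by do 2?[apply: imageD]; apply: image_z3; lia.
have [x ->] := zeta2_zf b0 a0; have [y ->] := zeta2_zf c0 d0.
rewrite -scalerAl -scalerAr; do 2!apply: imageZ.
have -> : (c + d)%N = (k - (b + a))%N by lia.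
by apply: (@image_Q (b + a)); lia.
Qed.

(** By depth: one and two vanish in even weight, three is the assumed identity,
    four is [zeta4_parity], whose product of double values is a multiple of
    some Q_u. *)
Lemma image_Fil (v : Fil 4 k) : in_image (Fil_incl v).
Proof.
have /lspanP[s Gs e] := valP v; rewrite /Fil_incl e.
rewrite big_seq; apply: big_ind => [||p /Gs[ks [ks_pos ks4 ksk ->]]].
- exact: image0.
- exact: imageD.
apply: imageZ; rewrite zetaAfE //.
case: ks ks_pos ks4 ksk => [|a [|b [|c [|d [|? ?]]]]] //=; rewrite ?addn0 ?andbT.
- by move=> _ _ k0; move: k_ge4; rewrite -k0.
- by move=> a0 _ _; rewrite zeta1_eq0 //; exact: image0.
- by move=> /andP[a0 b0] _ ab; rewrite zeta2_even ?ab //; exact: image0.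
- by move=> /and3P[a0 b0 c0] _ abc; apply: image_z3; rewrite // -addnA.
by move=> /and4P[a0 b0 c0 d0] _ abcd; apply: image_z4; rewrite // -!addnA.
Qed.

(** Spanning by H shows that the values lie in Fil_4. *)
Lemma g_Fil d : g d \in lspan (fun f : ZAf => exists ks : seq nat,
    [/\ all (leq 1) ks, (size ks <= 4)%N, sumn ks = k & f = zetaAf ks]).
Proof.
have /lspanP[s Hs ->] := dztH_span k_ge4 k_even d.
rewrite (big_morph g gD (raddf0 g)) big_seq; apply: rpred_sum => p.
move=> /Hs[r [t [/andP[r3 odd_r] /andP[t3 odd_t] rt ->]]].
rewrite gS; apply: rpredZ; apply: mem_lspan; exists [:: r.-1; 1; t.-1; 1]%N.
have all_pos : all (leq 1) [:: r.-1; 1; t.-1; 1]%N by rewrite /=; lia.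
split=> //; first by rewrite /=; lia.
by rewrite g_H // zetaAfE.
Qed.

End Construction.

Theorem theorem3 (k : nat) (k_ge4 : (4 <= k)%N) (k_even : ~~ odd k) :
  (forall d : dzt_space k,
     d \in lspan (fun h : dzt_space k => exists r s : nat,
             [/\ (3 <= r)%N && odd r, (3 <= s)%N && odd s, (r + s)%N = k
               & h = dztH k r s]))
  /\
  ((forall a b c : nat,
      (1 <= a)%N -> (1 <= b)%N -> (1 <= c)%N -> (a + b + c)%N = k ->
      zetaAf [:: a; b; c] =
        (-1) ^+ (b - 1)%N *: \sum_(1 <= n < k - 1)
            ('C(n, a) * 'C((k - 1 - n)%N, c))%N%:R
              *: zetaAf [:: n; 1%N; (k - 1 - n)%N]
        + (-1) ^+ (a + c)%N *: \sum_(1 <= i < b)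
            ('C((a + i)%N, a) * 'C((b + c - i)%N, c))%N%:R
              *: (zf (a + i)%N * zf (b + c - i)%N)) ->
   exists beta : {linear dzt_space k -> Fil 4 k},
     [/\ forall r s : nat,
           (3 <= r)%N && odd r -> (3 <= s)%N && odd s -> (r + s)%N = k ->
           Fil_incl (beta (dztH k r s))
             = zetaAf [:: (r - 1)%N; 1%N; (s - 1)%N; 1%N],
         forall beta' : {linear dzt_space k -> Fil 4 k},
           (forall r s : nat,
              (3 <= r)%N && odd r -> (3 <= s)%N && odd s -> (r + s)%N = k ->
              Fil_incl (beta' (dztH k r s))
                = zetaAf [:: (r - 1)%N; 1%N; (s - 1)%N; 1%N]) ->
           beta' =1 beta
       & forall z : Fil 4 k, exists d : dzt_space k, beta d = z]).
Proof.
split; first exact: dztH_span.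
move=> zeta_formula.
have [g [gZ gP]] := dzt_map k_ge4 k_even zeta_formula.
pose b0 (d : dzt_space k) : Fil 4 k :=
  exist _ (g d) (g_Fil k_ge4 k_even zeta_formula gZ gP d).
have b0_lin : linear b0.
  by move=> a u v; apply: val_inj; rewrite /= linearP.
pose bM := GRing.isLinear.Build rat (dzt_space k) (Fil 4 k) *:%R b0 b0_lin.
pose beta : {linear dzt_space k -> Fil 4 k} := HB.pack b0 bM.
have betaH r s : (3 <= r)%N && odd r -> (3 <= s)%N && odd s -> (r + s)%N = k ->
    Fil_incl (beta (dztH k r s)) = zetaAf [:: (r - 1)%N; 1%N; (s - 1)%N; 1%N].
  move=> /andP[r3 odd_r] /andP[s3 odd_s] rs.
  rewrite [LHS](g_H k_ge4 k_even zeta_formula gZ gP r3 s3 odd_r odd_s rs).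
  by rewrite !subn1 zetaAfE //=; lia.
exists beta; split=> [//|beta' beta'H d|z].
  apply: linear_eq_lspan (dztH_span k_ge4 k_even d) => _ [r [t [hr ht rt ->]]].
  by apply: Fil_incl_inj; rewrite beta'H // betaH.
have [d gd] := image_Fil k_ge4 k_even zeta_formula gZ gP z.
by exists d; apply: Fil_incl_inj.
Qed.
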